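(* Let $\mu$ be a positive Borel measure on $\mathbb R$ supported on at least two distinct points with $\int_{\mathbb R}(1+|t|)^{-1}d\mu(t)<\infty$, let $\alpha\in\mathbb R\setminus\{0\}$, and let $\nu$ be a positive Borel measure on $\mathbb R$. For compactly supported $C^1$ functions $f$ define $$Vf(s)=f(s)-\alpha\int_{\mathbb R}\frac{f(s)-f(t)}{s-t}\,d\mu(t)$$ (integrand at $t=s$ interpreted as $f'(s)$). Assume $V$ extends to a bounded operator $V:L^2(\mu)\to L^2(\nu)$ with $\operatorname{Ker}V=\{0\}$. Then there exists a measurable function $h$ with $1/h\in L^\infty(\nu)$ such that $M_hV:L^2(\mu)\to L^2(\nu)$ is unitary (equivalently, $V:L^2(\mu)\to L^2(|h|^2d\nu)$ is unitary). Moreover $U:=M_hV$ satisfies $UA_\alpha=M_sU$ (in the resolvent sense $U(A_\alpha-\lambda I)^{-1}=(M_s-\lambda I)^{-1}U$, $\lambda\notin\mathbb R$), where $M_s$ is multiplication by the independent variable in $L^2(\nu)$.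
   Context: $M_t$ denotes multiplication by the independent variable on $L^2(\mu)$. $A_\alpha$ denotes the rank one perturbation ''$M_t+\alpha(\,\cdot\,,\mathbf 1)\mathbf 1$'' of $M_t$ on $L^2(\mu)$, defined as the self-adjoint operator whose resolvent is, for $\lambda\in\mathbb C\setminus\mathbb R$, $(A_\alpha-\lambda I)^{-1}f=(M_t-\lambda I)^{-1}f-\frac{\alpha\int\frac{f(t)d\mu(t)}{t-\lambda}}{1+\alpha F(\lambda)}(M_t-\lambda I)^{-1}\mathbf 1$, with $F(\lambda)=\int\frac{d\mu(t)}{t-\lambda}$. *)

(* Defs.v *)
From HB Require Import structures.
From mathcomp Require Import all_boot all_order all_algebra.
From mathcomp Require Import all_classical all_reals all_analysis.
From mathcomp.real_closed Require Import complex.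
Set Implicit Arguments. Unset Strict Implicit. Unset Printing Implicit Defensive.
Import Order.TTheory GRing.Theory Num.Theory.
Import numFieldNormedType.Exports.
Local Open Scope classical_set_scope.
Local Open Scope ring_scope.
Local Open Scope complex_scope.

Notation mR R := (measurableTypeR R).
Notation bmeasure R := {measure set (mR R) -> \bar R}.

Section defs.
Context {R : realType}.
Implicit Types (mu nu : bmeasure R) (f g : R -> R[i]).

Definition cabs2 (z : R[i]) : R := (complex.Re z) ^+ 2 + (complex.Im z) ^+ 2.
Definition cabs (z : R[i]) : R := Num.sqrt (cabs2 z).

Definition cmeasurable f :=
  measurable_fun [set: mR R] (fun x : mR R => complex.Re (f x)) /\
  measurable_fun [set: mR R] (fun x : mR R => complex.Im (f x)).

Definition cint mu f : R[i] :=
  Complex (Rintegral mu [set: mR R] (fun x : mR R => complex.Re (f x)))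
          (Rintegral mu [set: mR R] (fun x : mR R => complex.Im (f x))).

Definition L2 mu f :=
  cmeasurable f /\ (\int[mu]_(x in [set: mR R]) (cabs2 (f x))%:E < +oo)%E.

Definition L2norm2 mu f : \bar R := (\int[mu]_(x in [set: mR R]) (cabs2 (f x))%:E)%E.

Definition aeq mu f g := {ae mu, forall x : mR R, f x = g x}.

Definition in_support mu (x : R) :=
  forall e : R, 0 < e -> (0 < mu [set y : mR R | (`|(y : R) - x| < e)%R])%E.

Definition C1c f :=
  (exists M : R, forall x : R, M < `|x| -> f x = 0) /\
  (forall x : R, derivable (fun y => complex.Re (f y)) x 1 /\
                 derivable (fun y => complex.Im (f y)) x 1) /\
  continuous (derive1 (fun y => complex.Re (f y))) /\
  continuous (derive1 (fun y => complex.Im (f y))).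

Definition cderiv f (s : R) : R[i] :=
  Complex (derive1 (fun y => complex.Re (f y)) s) (derive1 (fun y => complex.Im (f y)) s).

Definition dquot f (s t : R) : R[i] :=
  if t == s then cderiv f s else (f s - f t) / (s - t)%:C.

Definition Vop mu (alpha : R) f : R -> R[i] :=
  fun s => f s - alpha%:C * cint mu (fun t => dquot f s t).

Definition cauchyF mu (lam : R[i]) : R[i] := cint mu (fun t => (t%:C - lam)^-1).

(* resolvent (A_alpha - lambda I)^{-1} f of the rank one perturbation A_alpha *)
Definition resA mu (alpha : R) (lam : R[i]) f : R -> R[i] :=
  fun t => (t%:C - lam)^-1 * f t
    - (alpha%:C * cint mu (fun u => f u / (u%:C - lam)))
        / (1 + alpha%:C * cauchyF mu lam) * (t%:C - lam)^-1.

(* W : L^2(mu) -> L^2(nu) is a bounded linear operator (acting on representatives,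
   compatible with a.e. equality) extending V from the compactly supported C^1
   functions, with trivial kernel. *)
Definition bounded_injective_extension mu nu (alpha : R)
    (W : (R -> R[i]) -> (R -> R[i])) :=
  [/\ forall f, C1c f -> aeq nu (W f) (Vop mu alpha f),
      forall f g, L2 mu f -> L2 mu g -> aeq mu f g -> aeq nu (W f) (W g),
      forall (a : R[i]) f g, L2 mu f -> L2 mu g ->
        aeq nu (W (fun x => a * f x + g x)) (fun x => a * W f x + W g x),
      exists C : R, forall f, L2 mu f ->
        L2 nu (W f) /\ (L2norm2 nu (W f) <= C%:E * L2norm2 mu f)%E
    & forall f, L2 mu f -> aeq nu (W f) (fun _ => 0) -> aeq mu f (fun _ => 0)].

(* U : L^2(mu) -> L^2(nu) (linear, given on representatives) is unitary:
   isometric and onto *)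
Definition unitary_op mu nu (U : (R -> R[i]) -> (R -> R[i])) :=
  (forall f, L2 mu f -> L2 nu (U f) /\ L2norm2 nu (U f) = L2norm2 mu f) /\
  (forall g, L2 nu g -> exists f, L2 mu f /\ aeq nu (U f) g).

End defs.

(* Main.v *)
(* Write r_z(s) = 1/(s - z). A direct computation gives V(r_z f) = r_z (V f + alpha int r_z f dmu)
   for compactly supported C^1 functions f and, after approximation by cutoffs,
   V r_z = (1 + alpha F(z)) r_z. Together these say that V intertwines the resolvents of A_alpha
   and of M_s, first on C^1 functions and then on L^2(mu), because the resolvents of A_alpha at z
   and at conj z are adjoint to each other. In particular r_z lies in L^2(nu).

   Hence V V* commutes with multiplication by every r_z. The Newton iteration u -> u (3 - u^2) / 2
   started at 2 Re r_{a+i} converges boundedly to sign(s - a), so V V* commutes with multiplication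
   by indicators of rays, which forces V V* = M_phi. Here 0 <= phi <= |V|^2, and phi > 0 a.e. since
   the range of V contains a nowhere vanishing function. With h = phi^{-1/2}, the operator
   U = M_h V satisfies U U* = 1, and it is injective because V is, hence unitary.

   All inner products are real, (f, g) = Re int f conj(g); the adjoint of a complex linear operator
   is the same for the real and for the complex inner product. *)
Require Import Defs.
From HB Require Import structures.
From mathcomp Require Import all_boot all_order all_algebra.
From mathcomp Require Import all_classical all_reals all_analysis.
From mathcomp Require Import measurable_realfun ring lra.
From mathcomp.real_closed Require Import complex.
Set Implicit Arguments. Unset Strict Implicit. Unset Printing Implicit Defensive.
Import Order.TTheory GRing.Theory Num.Theory.
Import numFieldNormedType.Exports.
Local Open Scope classical_set_scope.
Local Open Scope ring_scope.
Local Open Scope complex_scope.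

(** Operators act on representatives, so every operator identity is an a.e. statement about one
    function, proved pointwise or by testing against all of L^2 ([ip_ext]). Three difficulties shape
    the proof. Since nu is an arbitrary Borel measure, a reference function in L^2(nu) has to be
    produced: dividing by 1 + alpha F(z) is legitimate because its imaginary part is alpha Im z
    times the squared norm of r_z, and then w = Im r_i = 1/(s^2 + 1) is a strictly positive element
    of L^2(nu). It replaces the constant 1 when the symbol is read off as phi = (V V^* w) / w. Next,
    explicit formulas exist only for C^1 functions; dualising twice carries the intertwining to
    L^2(mu), and density enters only as the triviality of an orthogonal complement. Last, phi may
    approach 0, so M_h may be unbounded; U is controlled on the level sets phi >= 1/(n + 1), found
    to be a contraction in the limit, and only then given an adjoint. *)

Local Notation Re := complex.Re.
Local Notation Im := complex.Im.

(** * Integration *)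

Section real_integrals.
Context d (T : measurableType d) (R : realType) (mu : {measure set T -> \bar R}).
Implicit Types f g : T -> R.

Definition intg f := mu.-integrable [set: T] (EFin \o f).
Definition Rint f : R := Rintegral mu [set: T] f.

Lemma intg_meas f : intg f -> measurable_fun [set: T] f.
Proof. by move=> /integrableP[/measurable_EFinP]. Qed.

Lemma intgD f g : intg f -> intg g -> intg (fun x => f x + g x).
Proof. by move=> fi gi; exact: (integrableD measurableT fi gi). Qed.

Lemma intgB f g : intg f -> intg g -> intg (fun x => f x - g x).
Proof. by move=> fi gi; exact: (integrableB measurableT fi gi). Qed.

Lemma intgZ c f : intg f -> intg (fun x => c * f x).
Proof. by move=> fi; exact: (integrableZl measurableT c fi). Qed.

Lemma intg_le f g : measurable_fun [set: T] f -> intg g ->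
  (forall x, `|f x| <= g x) -> intg f.
Proof.
move=> mf ig fg; apply: (le_integrable _ _ _ ig) => //; first exact/measurable_EFinP.
by move=> x _ /=; rewrite lee_fin (le_trans (fg x)) ?ler_norm.
Qed.

Lemma RintD f g : intg f -> intg g -> Rint (fun x => f x + g x) = Rint f + Rint g.
Proof. by move=> ? ?; apply: RintegralD. Qed.

Lemma RintB f g : intg f -> intg g -> Rint (fun x => f x - g x) = Rint f - Rint g.
Proof. by move=> ? ?; apply: RintegralB. Qed.

Lemma RintZ c f : intg f -> Rint (fun x => c * f x) = c * Rint f.
Proof. by move=> ?; apply: RintegralZl. Qed.

Lemma Rint_le f g : intg f -> intg g -> (forall x, f x <= g x) -> Rint f <= Rint g.
Proof. by move=> ? ? fg; apply: le_Rintegral => // x _; apply: fg. Qed.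

Lemma Rint_ge0 f : (forall x, 0 <= f x) -> 0 <= Rint f.
Proof. by move=> f0; apply: Rintegral_ge0. Qed.

Lemma Rint0 : Rint (fun=> 0) = 0.
Proof. by rewrite /Rint /Rintegral integral0_eq. Qed.

Lemma RintE f : intg f -> (\int[mu]_x (f x)%:E)%E = (Rint f)%:E.
Proof. by move=> fi; rewrite /Rint /Rintegral fineK// integrable_fin_num. Qed.

Lemma Rint_ae f g : measurable_fun [set: T] f -> measurable_fun [set: T] g ->
  {ae mu, forall x, f x = g x} -> Rint f = Rint g.
Proof.
move=> mf mg fg; rewrite /Rint /Rintegral; congr fine.
apply: ae_eq_integral => //; [exact/measurable_EFinP|exact/measurable_EFinP|].
by apply: filterS fg => x -> _.
Qed.

Lemma intg_ae f g : intg f -> measurable_fun [set: T] g ->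
  {ae mu, forall x, f x = g x} -> intg g.
Proof.
move=> /integrableP[mf fi] mg fg; apply/integrableP; split; first exact/measurable_EFinP.
rewrite -(@ae_eq_integral _ _ _ mu setT _ (fun x => `|(f x)%:E|)%E) //.
- exact: measurableT_comp.
- by apply: measurableT_comp => //; exact/measurable_EFinP.
- by apply: filterS fg => x -> _.
Qed.

Lemma ge0_intg f : measurable_fun [set: T] f -> (forall x, 0 <= f x) ->
  (\int[mu]_x (f x)%:E < +oo)%E -> intg f.
Proof.
move=> mf f0 fi; apply/integrableP; split; first exact/measurable_EFinP.
by under eq_integral do rewrite /= ger0_norm//.
Qed.

Lemma Rint_ge0_eq0 f : intg f -> (forall x, 0 <= f x) -> Rint f = 0 ->
  {ae mu, forall x, f x = 0}.
Proof.
move=> fi f0 If; have [mf _] := integrableP _ _ _ fi.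
have := (ae_eq_integral_abs mu measurableT mf).1; rewrite /ae_eq.
have -> : (\int[mu]_x `|(EFin \o f) x| = 0)%E.
  under eq_integral do rewrite /= ger0_norm//.
  by rewrite RintE// If.
by move=> /(_ erefl); apply: filterS => x /(_ Logic.I)[].
Qed.

Lemma Rint_dct (f_ : nat -> T -> R) f g :
  (forall n, measurable_fun [set: T] (f_ n)) -> measurable_fun [set: T] f -> intg g ->
  {ae mu, forall x, f_ n x @[n --> \oo] --> f x} ->
  (forall n x, `|f_ n x| <= g x) ->
  Rint (f_ n) @[n --> \oo] --> Rint f.
Proof.
move=> mf_ mf ig ff fg.
have [] := @dominated_convergence _ _ _ mu setT measurableT
  (fun n => EFin \o f_ n) (EFin \o f) (EFin \o g).
- by move=> n; exact/measurable_EFinP.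
- exact/measurable_EFinP.
- by apply: filterS ff => x fx _; apply: cvg_EFin => //; apply: nearW.
- exact: ig.
- by apply: nearW => x n _ /=; rewrite lee_fin.
move=> fi _ h.
have fni n : intg (f_ n) by apply: intg_le (fg n).
have E : (\int[mu]_x (EFin \o f) x)%E = (Rint f)%:E := RintE fi.
by rewrite E in h; move/fine_cvgP : h => [_].
Qed.

(** Fatou's lemma with integrability of the limit as part of the conclusion. Convergence holds only
    a.e., so the integral of f is first replaced by that of the pointwise liminf. *)
Lemma fatou_bound (f_ : nat -> T -> R) f M :
  (forall n, intg (f_ n)) -> (forall n x, 0 <= f_ n x) -> (forall x, 0 <= f x) ->
  measurable_fun [set: T] f ->
  {ae mu, forall x, f_ n x @[n --> \oo] --> f x} ->
  (forall n, Rint (f_ n) <= M) -> intg f /\ Rint f <= M.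
Proof.
move=> fi f0 fx0 mf ff fM.
have mfn n : measurable_fun [set: T] (EFin \o f_ n).
  by apply/measurable_EFinP; apply: intg_meas.
have le : (\int[mu]_x (f x)%:E <= M%:E)%E.
  rewrite (@ge0_ae_eq_integral _ _ _ mu setT _ (fun x => limn_einf (fun n => (f_ n x)%:E))) //.
  - apply: (le_trans (fatou mu measurableT mfn _)); first by move=> n x _; rewrite lee_fin.
    rewrite (_ : (fun n => _) = (fun n => (Rint (f_ n))%:E)); last first.
      by apply/funext => n; rewrite -RintE.
    rewrite limn_einf_lim; apply: lime_le; first exact: is_cvg_einfs.
    apply: nearW => n; apply: le_trans (_ : (Rint (f_ n))%:E <= _)%E; last by rewrite lee_fin.
    by apply: ereal_inf_lbound; exists n => /=.
  - exact/measurable_EFinP.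
  - apply: (eq_measurable_fun (fun x => - limn_esup (fun n => - (EFin \o f_ n) x))%E).
      by move=> x _; rewrite -limn_einfN; congr limn_einf; apply/funext => n; rewrite /= ?oppeK ?opprK.
    apply: measurableT_comp => //; apply: measurable_fun_limn_esup => n.
    exact: measurableT_comp.
  - by move=> x _; rewrite lee_fin.
  - move=> x _; rewrite limn_einf_lim; apply: lime_ge; first exact: is_cvg_einfs.
    by apply: nearW => n; apply: le_ereal_inf_tmp => _ [m _ <-]; rewrite lee_fin.
  - apply: filterS ff => x h _.
    rewrite (cvg_limn_einf_sup (_ : (f_ n x)%:E @[n --> \oo] --> (f x)%:E)).1 //.
    by apply: cvg_EFin => //; apply: nearW.
have i : intg f by apply: ge0_intg => //; rewrite (le_lt_trans le)// ltry.
by split => //; rewrite -lee_fin -RintE.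
Qed.

End real_integrals.

(** Telescoping bounds |u (n + m) - u n| by 2 K (2^-n - 2^-(n + m)). Hence every lower end u m - 2 K
    2^-m lies below every upper end u n + 2 K 2^-n, and the supremum of the lower ends serves as the
    limit. *)
Lemma geometric_cauchy (R : realType) (u : nat -> R) (K : R) :
  (forall n, `|u n.+1 - u n| <= K * 2^-1 ^+ n) ->
  exists l, forall n, `|l - u n| <= 2 * K * 2^-1 ^+ n.
Proof.
move=> uK.
have K0 : 0 <= K by have := le_trans (normr_ge0 _) (uK 0%N); rewrite expr0 mulr1.
have step m n : `|u (n + m)%N - u n| <= 2 * K * 2^-1 ^+ n - 2 * K * 2^-1 ^+ (n + m).
  elim: m => [|m IH]; first by rewrite addn0 !subrr normr0.
  rewrite addnS; have := uK (n + m)%N; set a := u _.+1; set b := u (n + m)%N in IH *.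
  have := ler_normD (a - b) (b - u n); rewrite addrA subrK => h1 h2.
  apply: (le_trans h1); rewrite [2^-1 ^+ (n + m).+1]exprS.
  set q := 2^-1 ^+ (n + m) in h2 IH *; nra.
have q0 n : 0 <= (2^-1 : R) ^+ n by rewrite exprn_ge0// invr_ge0.
pose a n := u n - 2 * K * 2^-1 ^+ n.
have Kq n : 0 <= 2 * K * 2^-1 ^+ n by rewrite !mulr_ge0.
have ab m n : a m <= u n + 2 * K * 2^-1 ^+ n.
  rewrite /a; have [mn|/ltnW nm] := leqP m n.
    have := step (n - m)%N m; rewrite subnKC// ler_norml => /andP[h1 h2].
    by have := Kq m; have := Kq n; lra.
  have := step (m - n)%N n; rewrite subnKC// ler_norml => /andP[h1 h2].
  by have := Kq m; have := Kq n; lra.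
have sa : has_sup (range a).
  by split; [exists (a 0%N); exists 0%N|exists (u 0%N + 2 * K * 2^-1 ^+ 0) => _ [m _ <-]; exact: ab].
exists (sup (range a)) => n; rewrite ler_norml; apply/andP; split.
  have : a n <= sup (range a) by apply: ub_le_sup; [exact: sa.2|exists n].
  by rewrite /a; lra.
rewrite lerBlDr addrC; apply: ge_sup; first exact: sa.1.
by move=> _ [m _ <-]; exact: ab.
Qed.

Lemma quad_form_discr (R : realFieldType) (a b c : R) : 0 <= a -> 0 <= b ->
  (forall s t, 0 <= s ^+ 2 * a + 2 * s * t * c + t ^+ 2 * b) -> c ^+ 2 <= a * b.
Proof.
move=> a0 b0 q.
have [b_eq0|bn0] := eqVneq b 0.
  (* For b = 0 the form takes the value - (a + 2) c^2 at this point. *)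
  have := q (c) (- (a + 1)); rewrite b_eq0 !mulr0 addr0.
  have [->|c0] := eqVneq c 0; first by rewrite expr0n.
  have : 0 < c ^+ 2 by rewrite exprn_even_gt0.
  nra.
have bp : 0 < b by rewrite lt_neqAle eq_sym bn0.
have := q b (- c).
have -> : b ^+ 2 * a + 2 * b * - c * c + (- c) ^+ 2 * b = b * (a * b - c ^+ 2) by ring.
by rewrite pmulr_rge0// subr_ge0.
Qed.

(** * Real square-integrable functions and their completeness *)

Section square_integrable.
Context d (T : measurableType d) (R : realType) (mu : {measure set T -> \bar R}).
Implicit Types f g u v : T -> R.
Local Notation intg := (intg mu).
Local Notation I := (Rint mu).

Definition sqint f := measurable_fun [set: T] f /\ intg (fun x => f x ^+ 2).

Lemma sqintM f g : sqint f -> sqint g -> intg (fun x => f x * g x).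
Proof.
move=> [mf fi] [mg gi]; apply: (intg_le _ (intgD fi gi)); first exact: measurable_funM.
by move=> x; have := sqr_ge0 (f x + g x); have := sqr_ge0 (f x - g x);
  have := sqr_ge0 (f x); have := sqr_ge0 (g x); rewrite ler_norml => *; nra.
Qed.

Lemma sqintZ c f : sqint f -> sqint (fun x => c * f x).
Proof.
move=> [mf fi]; split; first by apply: measurable_funM.
by under eq_fun do rewrite exprMn; apply: intgZ.
Qed.

Lemma sqintD f g : sqint f -> sqint g -> sqint (fun x => f x + g x).
Proof.
move=> [mf fi] [mg gi]; split; first exact: measurable_funD.
apply: (intg_le _ (intgD (intgZ 2 fi) (intgZ 2 gi))).
  by apply: measurable_funX; exact: measurable_funD.
by move=> x; rewrite ger0_norm ?sqr_ge0//; have := sqr_ge0 (f x - g x); nra.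
Qed.

Lemma sqintB f g : sqint f -> sqint g -> sqint (fun x => f x - g x).
Proof.
move=> fi gi; have := sqintD fi (sqintZ (-1) gi).
by under eq_fun do rewrite mulN1r.
Qed.

Lemma sqint0 : sqint (fun=> 0).
Proof.
split; first exact: measurable_cst.
by under eq_fun do rewrite expr0n/=; apply: integrable0.
Qed.

Lemma Rint_CS f g : sqint f -> sqint g ->
  I (fun x => f x * g x) ^+ 2 <= I (fun x => f x ^+ 2) * I (fun x => g x ^+ 2).
Proof.
move=> sf sg; have [mf fi] := sf; have [mg gi] := sg; have fgi := sqintM sf sg.
set a := I (fun x => f x ^+ 2); set b := I (fun x => g x ^+ 2); set c := I _.
have b0 : 0 <= b by apply: Rint_ge0 => x; exact: sqr_ge0.
have a0 : 0 <= a by apply: Rint_ge0 => x; exact: sqr_ge0.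
have q s t : 0 <= s ^+ 2 * a + 2 * s * t * c + t ^+ 2 * b.
  have i1 := intgZ (s ^+ 2) fi; have i2 := intgZ (2 * s * t) fgi; have i3 := intgZ (t ^+ 2) gi.
  rewrite /a /b /c -!RintZ// -(RintD i1 i2) -(RintD (intgD i1 i2) i3).
  by apply: Rint_ge0 => x; have := sqr_ge0 (s * f x + t * g x); nra.
exact: quad_form_discr.
Qed.

(** The rate 16^-n leaves 4^-n after the weight 4^n, so S has a finite integral; a single term of S
    then gives |f (n + 1) - f n| <= 2^-n sqrt S, which is the input of [geometric_cauchy]. *)
Lemma sqint_complete (f : nat -> T -> R) : (forall n, sqint (f n)) ->
  (forall n, I (fun x => (f n.+1 x - f n x) ^+ 2) <= 16^-1 ^+ n) ->
  exists2 g, sqint g & I (fun x => (f n x - g x) ^+ 2) @[n --> \oo] --> (0 : R).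
Proof.
move=> sf fd.
(* The sum S of 4^n |f_{n+1} - f_n|^2 is integrable, so the increments are O(2^-n) a.e. *)
pose D n x := 4 ^+ n * (f n.+1 x - f n x) ^+ 2.
have D0 n x : 0 <= D n x by rewrite mulr_ge0 ?sqr_ge0// exprn_ge0.
have Di n : intg (D n) by apply: (intgZ _ (sqintB (sf n.+1) (sf n)).2).
have mD n : measurable_fun [set: T] (EFin \o D n).
  by apply/measurable_EFinP; exact: intg_meas (Di n).
pose S x := (\sum_(0 <= n <oo) (D n x)%:E)%E.
have S0 x : (0 <= S x)%E by apply: nneseries_ge0 => n _ _; rewrite lee_fin.
have mS : measurable_fun [set: T] S.
  by apply: (@ge0_emeasurable_sum _ _ _ setT (fun n => EFin \o D n) xpredT) => // n x _ _; rewrite lee_fin.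
have Sfin : (\int[mu]_x S x < +oo)%E.
  rewrite integral_nneseries//; last by move=> n x _; rewrite lee_fin.
  apply: (@le_lt_trans _ _ (\sum_(0 <= n <oo) (4^-1 ^+ n)%:E)%E).
    apply: lee_nneseries => [n _ _|n _]; first by apply: integral_ge0 => x _; rewrite lee_fin.
    rewrite (RintE (Di n)) lee_fin /D RintZ; last exact: (sqintB (sf n.+1) (sf n)).2.
    apply: (le_trans (ler_wpM2l _ (fd n))); first by rewrite exprn_ge0.
    by rewrite -exprMn; apply: lerXn2r; rewrite ?nnegrE; lra.
  have := @cvg_geometric_series R 1 4^-1 _; rewrite ger0_norm; last by lra.
  move=> /(_ ltac:(lra)) h.
  have : limn (fun n => (series (geometric 1 4^-1) n)%:E : \bar R) = (1 / (1 - 4^-1) : R)%:E.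
    by apply/cvg_lim => //; apply: cvg_EFin => //; apply: nearW.
  rewrite (_ : (fun n => _) = (fun n => \sum_(0 <= k < n) (4^-1 ^+ k : R)%:E)%E).
    by move=> ->; rewrite ltry.
  apply/funext => n; rewrite sumEFin /series/=; congr EFin.
  by apply: eq_bigr => k _; rewrite /= mul1r.
have Si : mu.-integrable [set: T] S.
  by apply/integrableP; split => //; under eq_integral do rewrite gee0_abs//.
pose A := [set x | (S x < +oo)%E].
have mA : measurable A.
  by rewrite -[A]setTI; apply: emeasurable_fun_infty_o.
have Aae : {ae mu, forall x, A x}.
  apply: filterS (integrable_ae measurableT Si) => x /(_ Logic.I).
  by rewrite ge0_fin_numE.
pose s x := fine (S x) * \1_A x.
have s0 x : 0 <= s x by rewrite mulr_ge0 ?fine_ge0.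
have si : intg s.
  apply: ge0_intg => //.
    apply: measurable_funM; first exact: measurableT_comp.
    exact: measurable_indic.
  apply: le_lt_trans Sfin; apply: ge0_le_integral => //.
  - by move=> x _; rewrite lee_fin.
  - apply/measurable_EFinP; apply: measurable_funM; first exact: measurableT_comp.
    exact: measurable_indic.
  - move=> x _; rewrite /s indicE; have [/set_mem xA|_] := boolP (x \in A); last by rewrite mulr0.
    by rewrite mulr1 fineK// ge0_fin_numE.
(* Off A the sequence is set to 0, so it converges at every point and its limit is measurable;
   almost everywhere it is still [f n]. *)
pose h n x := f n x * \1_A x.
have hmeas n : measurable_fun [set: T] (h n).
  by apply: measurable_funM; [exact: (sf n).1|exact: measurable_indic].
have hb x : exists l, forall n, `|l - h n x| <= 2 * Num.sqrt (s x) * 2^-1 ^+ n.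
  apply: geometric_cauchy => n; rewrite /h /s !indicE.
  have [/set_mem xA|_] := boolP (x \in A); last by rewrite !mulr0 subrr normr0 sqrtr0 mul0r.
  rewrite !mulr1.
  have Dle : D n x <= fine (S x).
    rewrite -lee_fin fineK; last by rewrite ge0_fin_numE.
    rewrite /S (nneseries_split 0 n.+1); last by move=> k _; rewrite lee_fin.
    rewrite add0n big_nat_recr//= -[leLHS]add0e; apply: (@le_trans _ _ (\sum_(0 <= k < n) (D k x)%:E + (D n x)%:E)%E).
      by apply: leeD => //; apply: sume_ge0 => k _; rewrite lee_fin.
    by rewrite leeDl//; apply: nneseries_ge0 => k _ _; rewrite lee_fin.
  rewrite -(@ler_pXn2r _ 2)// ?nnegrE ?mulr_ge0 ?sqrtr_ge0 ?exprn_ge0 ?invr_ge0//.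
  rewrite real_normK ?num_real// exprMn sqr_sqrtr ?fine_ge0//.
  rewrite -exprM mulnC exprM -(@ler_pM2l _ (4 ^+ n)) ?exprn_gt0//.
  apply: (le_trans Dle); rewrite mulrCA -exprMn.
  by rewrite (_ : 4 * 2^-1 ^+ 2 = 1 :> R) ?expr1n ?mulr1// expr2; field.
have [g gP] := choice hb.
have hg x : h n x @[n --> \oo] --> g x.
  apply/cvgrPdist_le => e e0.
  have : (2 * Num.sqrt (s x)) * 2^-1 ^+ n @[n --> \oo] --> 2 * Num.sqrt (s x) * 0.
    apply: cvgM; first exact: cvg_cst.
    by apply: cvg_expr; rewrite ger0_norm; lra.
  rewrite mulr0 => /cvgrPdist_le/(_ e e0); apply: filterS => n.
  rewrite sub0r normrN ger0_norm ?mulr_ge0 ?sqrtr_ge0 ?exprn_ge0 ?invr_ge0//.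
  exact: le_trans.
have mg : measurable_fun [set: T] g.
  by apply: (measurable_fun_cvg hmeas) => x _; exact: hg.
have fgi n : sqint (fun x => f n x - g x) /\ I (fun x => (f n x - g x) ^+ 2) <= 4 * I s * 4^-1 ^+ n.
  have mfg : measurable_fun [set: T] (fun x => (f n x - g x) ^+ 2).
    by apply: measurable_funX; apply: measurable_funB => //; exact: (sf n).1.
  have mhg : measurable_fun [set: T] (fun x => (h n x - g x) ^+ 2).
    by apply: measurable_funX; apply: measurable_funB.
  have ae : {ae mu, forall x, (h n x - g x) ^+ 2 = (f n x - g x) ^+ 2}.
    by apply: filterS Aae => x xA; rewrite /h indicE mem_set// mulr1.
  have le x : (h n x - g x) ^+ 2 <= 4 * 4^-1 ^+ n * s x.
    rewrite -(real_normK (num_real _)) distrC.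
    have q0 : 0 <= 2 * Num.sqrt (s x) * 2^-1 ^+ n.
      by rewrite !mulr_ge0 ?sqrtr_ge0 ?exprn_ge0 ?invr_ge0.
    have := gP x n; rewrite -(@ler_pXn2r _ 2)// => /le_trans; apply.
    rewrite !exprMn sqr_sqrtr// -exprM mulnC exprM.
    rewrite (_ : 2^-1 ^+ 2 = 4^-1 :> R); first by rewrite mulrAC -natrX.
    by rewrite expr2; field.
  have hi : intg (fun x => (h n x - g x) ^+ 2).
    apply: (intg_le mhg (intgZ (4 * 4^-1 ^+ n) si)) => x.
    by rewrite ger0_norm ?sqr_ge0.
  split; first by split; [apply: measurable_funB => //; exact: (sf n).1|exact: intg_ae ae].
  rewrite -(Rint_ae _ _ ae)//.
  by rewrite mulrAC -RintZ//; apply: Rint_le => //; exact: intgZ.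
exists g.
  have := sqintB (sf 0%N) (fgi 0%N).1.
  by under eq_fun do rewrite opprB addrC subrK.
apply: (@squeeze_cvgr _ _ _ _ (fun=> 0) (fun n => 4 * I s * 4^-1 ^+ n)).
- by apply: nearW => n; rewrite (fgi n).2 andbT; apply: Rint_ge0 => x; exact: sqr_ge0.
- exact: cvg_cst.
- rewrite -[X in _ --> X](mulr0 (4 * I s)); apply: cvgM; first exact: cvg_cst.
  by apply: cvg_expr; rewrite ger0_norm; lra.
Qed.

End square_integrable.

(** * Riesz representation by minimisation *)

Section riesz.
Context d (T : measurableType d) (R : realType) (mu : {measure set T -> \bar R}).
Implicit Types f g u v : T -> R.
Local Notation intg := (intg mu).
Local Notation I := (Rint mu).
Local Notation sqint := (sqint mu).
Local Notation N f := (I (fun x => f x ^+ 2)).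

Lemma Rint_sqrD f u (t : R) : sqint f -> sqint u ->
  N (fun x => f x + t * u x) = N f + 2 * t * I (fun x => f x * u x) + t ^+ 2 * N u.
Proof.
move=> sf su; have fu := sqintM sf su.
have i2 := intgZ (2 * t) fu; have i3 := intgZ (t ^+ 2) su.2.
rewrite -RintZ// -RintZ//; last exact: su.2.
rewrite -(RintD sf.2 i2) -(RintD (intgD sf.2 i2) i3).
by congr (Rint mu); apply/funext => x; ring.
Qed.

Lemma sqint_riesz (l : (T -> R) -> R) (C : R) :
  (forall c f g, sqint f -> sqint g -> l (fun x => c * f x + g x) = c * l f + l g) ->
  (forall f, sqint f -> l f ^+ 2 <= C * N f) ->
  exists2 g, sqint g & forall u, sqint u -> l u = I (fun x => u x * g x).
Proof.
move=> llin lC.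
have N0 f : 0 <= N f by apply: Rint_ge0 => x; exact: sqr_ge0.
have lD t f u : sqint f -> sqint u -> l (fun x => f x + t * u x) = l f + t * l u.
  move=> sf su; rewrite addrC -llin//; congr l; apply/funext => x; exact: addrC.
(* The representative minimises J; a minimising sequence is Cauchy by the parallelogram law. *)
pose J f := N f - 2 * l f.
pose E := [set J f | f in [set f | sqint f]].
have El : has_lbound E.
  (* Complete the square: with c = |C| + 1 > 0, (l f)^2 <= c N f gives c (N f - 2 l f) >= (l f)^2 -
     2 c (l f) >= - c^2. *)
  exists (- (`|C| + 1)) => _ [f sf <-]; rewrite /J.
  have := lC _ sf; have := N0 f; have := ler_norm C; have := normr_ge0 C.
  set n := N f; set a := l f; set c := `|C| => c0 Cc n0 h.
  have h1 : a ^+ 2 <= (c + 1) * n by apply: (le_trans h); nra.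
  have c1 : 0 < c + 1 by lra.
  rewrite -(ler_pM2l c1); have := sqr_ge0 (a - (c + 1)); nra.
have Ei : has_inf E by split => //; exists (J (fun=> 0)), (fun=> 0) => //; exact: sqint0.
set m := inf E.
have Jm f : sqint f -> m <= J f by move=> sf; apply: ge_inf => //; exists f.
(* By the parallelogram law the squared distance of two almost minimisers is at most twice the sum
   of their excesses over m. The factor 1/4 turns this into the rate required by
   [sqint_complete]. *)
have ex n : exists f, sqint f /\ J f < m + 4^-1 * 16^-1 ^+ n.
  have e0 : 0 < 4^-1 * 16^-1 ^+ n :> R by rewrite mulr_gt0 ?exprn_gt0 ?invr_gt0.
  by have [_ [f sf <-] fm] := inf_adherent e0 Ei; exists f.
have [f fP] := choice ex.
have sf n : sqint (f n) := (fP n).1.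
have q0 n : 0 <= 16^-1 ^+ n :> R by rewrite exprn_ge0 ?invr_ge0.
have fd n : N (fun x => f n.+1 x - f n x) <= 16^-1 ^+ n.
  have := Rint_sqrD (-1) (sf n.+1) (sf n); under eq_fun do rewrite mulN1r.
  have := Rint_sqrD 1 (sf n.+1) (sf n); under eq_fun do rewrite mul1r.
  have sD := sqintD (sf n.+1) (sf n).
  have := Jm _ (sqintZ 2^-1 sD); rewrite /J.
  under eq_fun do rewrite exprMn.
  have lZ g : sqint g -> l (fun x => 2^-1 * g x) = 2^-1 * l g.
    have l0 : l (fun=> 0) = 0.
      have := llin 1 _ _ (sqint0 mu) (sqint0 mu); under eq_fun do rewrite mulr0 add0r.
      by lra.
    move=> sg; have := llin 2^-1 g (fun=> 0) sg (sqint0 mu).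
    by under eq_fun do rewrite addr0; rewrite l0 addr0.
  rewrite (RintZ _ sD.2) lZ// (_ : l (fun x => f n.+1 x + f n x) = l (f n.+1) + l (f n)); last first.
    by have := lD 1 _ _ (sf n.+1) (sf n); under eq_fun do rewrite mul1r; rewrite mul1r.
  have := (fP n).2; have := (fP n.+1).2; rewrite /J exprS.
  set q := 16^-1 ^+ n; have : 0 <= q := q0 n.
  set a := N (f n.+1); set b := N (f n); set c := I (fun x => f n.+1 x * f n x).
  set D1 := N (fun x => _ + _); set D2 := N (fun x => _ - _).
  set la := l _; set lb := l _ => *; nra.
have [g sg gP] := sqint_complete sf fd.
exists g => // u su.
have fu : I (fun x => f n x * u x) @[n --> \oo] --> I (fun x => g x * u x).
  apply/cvgrPdist_le => e e0.
  have e1 : 0 < e ^+ 2 / (N u + 1).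
    by apply: divr_gt0; [rewrite exprn_gt0|have := N0 u; lra].
  move/cvgrPdist_le : gP => /(_ _ e1); apply: filterS => n.
  rewrite sub0r normrN ger0_norm// => h.
  rewrite -RintB; [|exact: sqintM..].
  have sfg := sqintB (sf n) sg.
  rewrite (_ : (fun x => _) = (fun x => (f n x - g x) * (- u x))); last by apply/funext => x; ring.
  have su' : sqint (fun x => - u x).
    by have := sqintZ (-1) su; under eq_fun do rewrite mulN1r.
  rewrite -(@ler_pXn2r _ 2)// ?nnegrE//; last exact: ltW.
  rewrite real_normK ?num_real//; apply: (le_trans (Rint_CS sfg su')).
  under [X in _ * I X]eq_fun do rewrite sqrrN.
  apply: (le_trans (ler_wpM2r (N0 u) h)).
  rewrite mulrAC ler_pdivrMr; last by have := N0 u; lra.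
  by rewrite ler_wpM2l ?sqr_ge0//; lra.
set c := I (fun x => g x * u x) in fu.
(* First variation: [J (f n + t u) >= m], while [J (f n)] exceeds m by an amount tending to 0. Being
   nonnegative for all t, the quadratic has no linear term. *)
have main t : 0 <= t ^+ 2 * N u + 2 * t * (c - l u).
  have h n : 0 <= 4^-1 * 16^-1 ^+ n + (t ^+ 2 * N u + 2 * t * (I (fun x => f n x * u x) - l u)).
    have := Jm _ (sqintD (sf n) (sqintZ t su)); rewrite /J Rint_sqrD// lD//.
    by have := (fP n).2; rewrite /J; lra.
  have : 4^-1 * 16^-1 ^+ n + (t ^+ 2 * N u + 2 * t * (I (fun x => f n x * u x) - l u)) @[n --> \oo]
     --> 4^-1 * 0 + (t ^+ 2 * N u + 2 * t * (c - l u)).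
    apply: cvgD; first by apply: cvgM; [exact: cvg_cst|apply: cvg_expr; rewrite ger0_norm; lra].
    apply: cvgD; first exact: cvg_cst.
    apply: cvgM; first exact: cvg_cst.
    by apply: cvgB => //; exact: cvg_cst.
  by rewrite mulr0 add0r => /cvgr_to_ge; apply; apply: nearW.
suff : c - l u = 0.
  move/eqP; rewrite subr_eq0 => /eqP <-; congr (Rint mu); apply/funext => x; exact: mulrC.
have [//|cn] := eqVneq (c - l u) 0.
(* Near the minimum of the quadratic; the added 1 keeps the denominator positive when N u = 0. *)
have := main (- (c - l u) / (N u + 1)); have := N0 u.
have : 0 < (c - l u) ^+ 2 by rewrite exprn_even_gt0.
set n := N u; set e := c - l u => e0 n0.
rewrite (_ : _ + _ = - (e ^+ 2 * (n + 2) / (n + 1) ^+ 2)).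
  rewrite oppr_ge0 leNgt => /negP; case; rewrite divr_gt0// ?exprn_gt0//; last by lra.
  by rewrite mulr_gt0//; lra.
by field; lra.
Qed.

End riesz.

(** Open rays are stable under intersection and generate the Borel sets, and the sets over which p
    integrates to 0 form a Dynkin system: the vanishing total integral supplies complements,
    integrability of p supplies disjoint unions. *)
Lemma ray_integral_ae0 (R : realType) (m : bmeasure R) (p : R -> R) : intg m p ->
  Rint m p = 0 -> (forall a, Rint m (fun x : mR R => p x * \1_(`]a, +oo[%classic) x) = 0) ->
  {ae m, forall x, p x = 0}.
Proof.
move=> pi p0 pray.
have mE : @measurable _ (mR R) = <<s @RGenOInfty.G R >>.
  exact: (RGenOInfty.measurableE R).
have rayP (E : set (mR R)) : measurable E ->
    Rint m (fun x : mR R => p x * \1_E x) = 0 -> (\int[m]_(x in E) (p x)%:E = 0)%E.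
  move=> mEE E0.
  have ii : intg m (fun x : mR R => p x * \1_E x).
    apply: (intg_le _ (_ : intg m (fun x => `|p x|))).
    - by apply: measurable_funM; [exact: intg_meas pi|exact: measurable_indic].
    - exact: (integrable_norm pi).
    - by move=> x; rewrite indicE normrM; case: (x \in E); rewrite /= ?normr1 ?normr0 ?mulr1 ?mulr0.
  have h := RintE ii; rewrite E0 in h; rewrite integral_mkcond -[RHS]h; congr integral.
  apply/funext => x; rewrite /patch indicE; case: ifPn => _; first by rewrite mulr1.
  by rewrite mulr0.
have main : forall E, measurable E -> (\int[m]_(x in E) (p x)%:E = 0)%E.
  rewrite [in X in forall E, X E -> _]mE.
  apply: dynkin_induction => //.
  - move=> _ _ [a ->] [b ->]; exists (Num.max a b).
    by apply/seteqP; split => x; rewrite /= !in_itv/= !andbT gt_max => /andP.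
  - by rewrite RintE// p0.
  - move=> _ [a ->]; apply: rayP => //.
  - move=> S mS S0; have := @integral_setU _ _ _ m S (~` S) (EFin \o p) mS (measurableC mS).
    rewrite setUv S0 add0e (RintE pi) p0 => <- //; first by case/integrableP : pi.
    by rewrite disj_set2E setICr.
  - move=> F mF tF F0.
    rewrite integral_bigcup//; first by rewrite eseries0.
    by apply: (integrableS measurableT) => //; exact: bigcup_measurable.
have := @integral_ae_eq _ _ _ m setT measurableT (cst 0%E) (EFin \o p) pi.
case.
- exact: measurable_cst.
- by move=> E _ mEE; rewrite main// integral0.
- move=> A [mA A0 sA]; exists A; split => // x /= px; apply: sA => /= h; apply: px.
  by case: (h Logic.I).
Qed.

(** * Complex square-integrable functions *)

Section complex_arith.
Context {R : realType}.
Implicit Types a b : R[i].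

Lemma cReD a b : Re (a + b) = Re a + Re b. Proof. by case: a; case: b. Qed.
Lemma cImD a b : Im (a + b) = Im a + Im b. Proof. by case: a; case: b. Qed.
Lemma cReN a : Re (- a) = - Re a. Proof. by case: a. Qed.
Lemma cImN a : Im (- a) = - Im a. Proof. by case: a. Qed.
Lemma cReM a b : Re (a * b) = Re a * Re b - Im a * Im b. Proof. by case: a; case: b. Qed.
Lemma cImM a b : Im (a * b) = Re a * Im b + Im a * Re b. Proof. by case: a; case: b. Qed.
Lemma cReV a : Re a^-1 = Re a / cabs2 a. Proof. by case: a. Qed.
Lemma cImV a : Im a^-1 = - (Im a / cabs2 a). Proof. by case: a. Qed.
Lemma cReJ a : Re (conjc a) = Re a. Proof. by case: a. Qed.
Lemma cImJ a : Im (conjc a) = - Im a. Proof. by case: a. Qed.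
Definition ReImE := (cReD, cImD, cReN, cImN, cReM, cImM, cReJ, cImJ).

Lemma complex_eq a b : Re a = Re b -> Im a = Im b -> a = b.
Proof. by case: a; case: b => /= ? ? ? ? -> ->. Qed.

Lemma cabs2_ge0 a : 0 <= cabs2 a.
Proof. by rewrite addr_ge0// sqr_ge0. Qed.

Lemma cabs2_eq0 a : cabs2 a = 0 -> a = 0.
Proof.
move=> h; apply: complex_eq; rewrite /=; apply/eqP; rewrite -sqrf_eq0;
  have := sqr_ge0 (Re a); have := sqr_ge0 (Im a); rewrite /cabs2 in h => *;
  apply/eqP; lra.
Qed.

Lemma cabs2_gt0 a : a != 0 -> 0 < cabs2 a.
Proof.
by move=> a0; rewrite lt_neqAle cabs2_ge0 andbT eq_sym; apply: contra_neq a0 => /cabs2_eq0.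
Qed.

Lemma cabs2M a b : cabs2 (a * b) = cabs2 a * cabs2 b.
Proof. by rewrite /cabs2 !ReImE; ring. Qed.

Lemma cabs2V a : cabs2 a^-1 = (cabs2 a)^-1.
Proof.
have [->|a0] := eqVneq a 0; first by rewrite invr0 /cabs2 /= !expr0n/= addr0 invr0.
have c0 : cabs2 a != 0 by rewrite gt_eqF// cabs2_gt0.
by apply: (mulfI c0); rewrite -cabs2M !mulfV// /cabs2 /= expr1n expr0n addr0.
Qed.

End complex_arith.

Section complex_L2.
Context {R : realType} (m : bmeasure R).
Implicit Types f g u : R -> R[i].
Local Notation I := (Rint m).
Local Notation intg := (intg m).

Lemma cmeasurableM u f : cmeasurable u -> cmeasurable f -> cmeasurable (fun x => u x * f x).
Proof.
move=> [mu1 mu2] [mf1 mf2]; split.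
  under eq_fun do rewrite cReM.
  by apply: measurable_funB; apply: measurable_funM.
under eq_fun do rewrite cImM.
by apply: measurable_funD; apply: measurable_funM.
Qed.

Lemma cmeasurableD u f : cmeasurable u -> cmeasurable f -> cmeasurable (fun x => u x + f x).
Proof.
move=> [mu1 mu2] [mf1 mf2]; split.
  by under eq_fun do rewrite cReD; apply: measurable_funD.
by under eq_fun do rewrite cImD; apply: measurable_funD.
Qed.

Lemma cmeasurableJ f : cmeasurable f -> cmeasurable (fun x => conjc (f x)).
Proof.
move=> [mf1 mf2]; split; first by under eq_fun do rewrite cReJ.
by under eq_fun do rewrite cImJ; apply: measurable_funN.
Qed.

Lemma cmeasurable_cst (c : R[i]) : cmeasurable (fun=> c).
Proof. by split; exact: measurable_cst. Qed.

Lemma cmeasurable_real (p : R -> R) : measurable_fun [set: mR R] (p : mR R -> R) ->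
  cmeasurable (fun x => (p x)%:C).
Proof. by move=> mp; split => //; exact: measurable_cst. Qed.

Lemma cmeasurable_cabs2 f : cmeasurable f ->
  measurable_fun [set: mR R] (fun x : mR R => cabs2 (f x)).
Proof. by move=> [mf1 mf2]; apply: measurable_funD; apply: measurable_funX. Qed.

Lemma L2P f : L2 m f <-> sqint m (fun x : mR R => Re (f x)) /\ sqint m (fun x : mR R => Im (f x)).
Proof.
split=> [[mf fi]|[[mf1 i1] [mf2 i2]]].
  have i : intg (fun x : mR R => cabs2 (f x)).
    apply: ge0_intg => //; first exact: cmeasurable_cabs2.
    by move=> x; exact: cabs2_ge0.
  case: mf => mf1 mf2.
  by split; split => //; apply: (intg_le _ i); rewrite /=;
    [exact: measurable_funX|move=> x; rewrite ger0_norm ?sqr_ge0// /cabs2 ?lerDl ?lerDr ?sqr_ge0|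
    exact: measurable_funX|move=> x; rewrite ger0_norm ?sqr_ge0// /cabs2 ?lerDl ?lerDr ?sqr_ge0].
split; first by split.
by rewrite (RintE (intgD i1 i2)) ltry.
Qed.

Lemma L2_cabs2 f : L2 m f -> intg (fun x : mR R => cabs2 (f x)).
Proof. by move=> /L2P[[_ i1] [_ i2]]; exact: intgD. Qed.

Lemma L2_le f g : cmeasurable f -> L2 m g -> (forall x, cabs2 (f x) <= cabs2 (g x)) -> L2 m f.
Proof.
move=> mf Lg fg; split => //; rewrite (@RintE _ _ _ m (fun x => cabs2 (f x))) ?ltry//.
apply: (intg_le _ (L2_cabs2 Lg)); first exact: cmeasurable_cabs2.
by move=> x; rewrite ger0_norm ?cabs2_ge0.
Qed.

Lemma L2D f g : L2 m f -> L2 m g -> L2 m (fun x => f x + g x).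
Proof.
move=> /L2P[f1 f2] /L2P[g1 g2]; apply/L2P; split.
  by under eq_fun do rewrite cReD; exact: sqintD.
by under eq_fun do rewrite cImD; exact: sqintD.
Qed.

Lemma L2M u f K : cmeasurable u -> (forall x, cabs2 (u x) <= K) -> L2 m f ->
  L2 m (fun x => u x * f x).
Proof.
move=> mu uK Lf; split; first exact: cmeasurableM Lf.1.
rewrite (@RintE _ _ _ m (fun x => cabs2 (u x * f x))) ?ltry//.
apply: (intg_le _ (intgZ K (L2_cabs2 Lf))); first by apply: cmeasurable_cabs2; exact: cmeasurableM Lf.1.
by move=> x; rewrite ger0_norm ?cabs2_ge0// cabs2M ler_wpM2r ?cabs2_ge0.
Qed.

Lemma L2Z (c : R[i]) f : L2 m f -> L2 m (fun x => c * f x).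
Proof. exact: (L2M (cmeasurable_cst c) (fun=> lexx _)). Qed.

Lemma L2N f : L2 m f -> L2 m (fun x => - f x).
Proof. by move=> Lf; have := L2Z (-1) Lf; under eq_fun do rewrite mulN1r. Qed.

Lemma L2B f g : L2 m f -> L2 m g -> L2 m (fun x => f x - g x).
Proof. by move=> Lf /L2N; exact: L2D. Qed.

Lemma L2_0 : L2 m (fun=> 0).
Proof. by apply/L2P; split; exact: sqint0. Qed.

Definition n2 f : R := I (fun x : mR R => cabs2 (f x)).
Definition ip f g : R := I (fun x : mR R => Re (f x) * Re (g x) + Im (f x) * Im (g x)).

Lemma n2_ge0 f : 0 <= n2 f.
Proof. by apply: Rint_ge0 => x; exact: cabs2_ge0. Qed.

Lemma L2norm2E f : L2 m f -> L2norm2 m f = (n2 f)%:E.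
Proof. by move=> Lf; exact: RintE (L2_cabs2 Lf). Qed.

Lemma ip_intg f g : L2 m f -> L2 m g ->
  intg (fun x : mR R => Re (f x) * Re (g x) + Im (f x) * Im (g x)).
Proof. by move=> /L2P[f1 f2] /L2P[g1 g2]; apply: intgD; exact: sqintM. Qed.

Lemma ipC f g : ip f g = ip g f.
Proof. by congr (Rint m); apply/funext => x; ring. Qed.

Lemma ipff f : ip f f = n2 f.
Proof. by congr (Rint m); apply/funext => x; rewrite /cabs2; ring. Qed.

Lemma ipDl f g k : L2 m f -> L2 m g -> L2 m k ->
  ip (fun x => f x + g x) k = ip f k + ip g k.
Proof.
move=> Lf Lg Lk; rewrite /ip -(RintD (ip_intg Lf Lk) (ip_intg Lg Lk)).
by congr (Rint m); apply/funext => x; rewrite !ReImE; ring.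
Qed.

Lemma ipZl (c : R) f k : L2 m f -> L2 m k ->
  ip (fun x => c%:C * f x) k = c * ip f k.
Proof.
move=> Lf Lk; rewrite /ip -(RintZ c (ip_intg Lf Lk)).
by congr (Rint m); apply/funext => x; rewrite !ReImE /=; ring.
Qed.

Lemma ipMl u f k : ip (fun x => u x * f x) k = ip f (fun x => conjc (u x) * k x).
Proof. by congr (Rint m); apply/funext => x; rewrite !ReImE; ring. Qed.

Lemma ipNl f k : L2 m f -> L2 m k -> ip (fun x => - f x) k = - ip f k.
Proof.
move=> Lf Lk; rewrite -mulN1r -ipZl//; congr ip; apply/funext => x.
by apply: complex_eq; rewrite !ReImE /=; ring.
Qed.

Lemma ipBl f g k : L2 m f -> L2 m g -> L2 m k ->
  ip (fun x => f x - g x) k = ip f k - ip g k.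
Proof. by move=> Lf Lg Lk; rewrite ipDl ?ipNl//; exact: L2N. Qed.

Lemma ip0l k : ip (fun=> 0) k = 0.
Proof. by rewrite -[RHS](Rint0 m); congr (Rint m); apply/funext => x /=; ring. Qed.

Lemma ip_CS f g : L2 m f -> L2 m g -> ip f g ^+ 2 <= n2 f * n2 g.
Proof.
move=> Lf Lg; apply: quad_form_discr; try exact: n2_ge0.
move=> s t; have i1 := intgZ (s ^+ 2) (L2_cabs2 Lf).
have i2 := intgZ (2 * s * t) (ip_intg Lf Lg); have i3 := intgZ (t ^+ 2) (L2_cabs2 Lg).
rewrite /n2 /ip -RintZ; last exact: L2_cabs2.
rewrite -RintZ; last exact: ip_intg.
rewrite -RintZ; last exact: L2_cabs2.
rewrite -(RintD i1 i2) -(RintD (intgD i1 i2) i3).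
apply: Rint_ge0 => x; have := sqr_ge0 (s * Re (f x) + t * Re (g x)).
by have := sqr_ge0 (s * Im (f x) + t * Im (g x)); rewrite /cabs2; nra.
Qed.

Lemma ip_ae f f' k : cmeasurable f -> cmeasurable f' -> cmeasurable k -> aeq m f f' ->
  ip f k = ip f' k.
Proof.
move=> [? ?] [? ?] [? ?] ff'; apply: Rint_ae.
- by apply: measurable_funD; apply: measurable_funM.
- by apply: measurable_funD; apply: measurable_funM.
- by apply: filterS ff' => x ->.
Qed.

Lemma n2_ae f f' : cmeasurable f -> cmeasurable f' -> aeq m f f' -> n2 f = n2 f'.
Proof.
move=> mf mf' ff'; apply: Rint_ae; try exact: cmeasurable_cabs2.
by apply: filterS ff' => x ->.
Qed.

Lemma L2_ae f f' : L2 m f -> cmeasurable f' -> aeq m f f' -> L2 m f'.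
Proof.
move=> Lf mf' ff'; split => //.
rewrite (@RintE _ _ _ m (fun x => cabs2 (f' x))) ?ltry//.
apply: (intg_ae (L2_cabs2 Lf)); first exact: cmeasurable_cabs2.
by apply: filterS ff' => x ->.
Qed.

Lemma n2_eq0 f : L2 m f -> n2 f = 0 -> aeq m f (fun=> 0).
Proof.
move=> Lf f0; have := Rint_ge0_eq0 (L2_cabs2 Lf) (fun x => cabs2_ge0 _) f0.
by apply: filterS => x /cabs2_eq0.
Qed.

Lemma aeq_sym f g : aeq m f g -> aeq m g f.
Proof. by apply: filterS => x ->. Qed.

Lemma aeq_trans f g k : aeq m f g -> aeq m g k -> aeq m f k.
Proof. by apply: filterS2 => x -> ->. Qed.

Lemma ip_ext f g : L2 m f -> L2 m g -> (forall k, L2 m k -> ip f k = ip g k) -> aeq m f g.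
Proof.
move=> Lf Lg fg; have Lfg := L2B Lf Lg.
have : aeq m (fun x => f x - g x) (fun=> 0).
  by apply: n2_eq0 => //; rewrite -ipff ipBl// fg// subrr.
by apply: filterS => x /eqP; rewrite subr_eq0 => /eqP.
Qed.

End complex_L2.

(** The real Riesz theorem is applied twice, to u -> (W u, k) and u -> (W (i u), k) with u real; the
    two representatives are the real and imaginary parts of [Ws k]. In [riesz], [j] is the embedding
    of the reals as the real or the imaginary axis. *)
Lemma ex_adjoint (R : realType) (mu nu : bmeasure R) (W : (R -> R[i]) -> R -> R[i]) (C : R) :
  (forall a f g, L2 mu f -> L2 mu g ->
        aeq nu (W (fun x => a * f x + g x)) (fun x => a * W f x + W g x)) ->
  (forall f, L2 mu f -> L2 nu (W f) /\ (L2norm2 nu (W f) <= C%:E * L2norm2 mu f)%E) ->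
  exists Ws, forall k, L2 nu k -> L2 mu (Ws k) /\
    forall f, L2 mu f -> ip nu (W f) k = ip mu f (Ws k).
Proof.
move=> Wlin WC.
have WL f : L2 mu f -> L2 nu (W f) by move=> /WC[].
have Wn f : L2 mu f -> n2 nu (W f) <= C * n2 mu f.
  by move=> Lf; have [LW] := WC f Lf; rewrite !L2norm2E// lee_fin.
suff h k : exists v, L2 nu k -> L2 mu v /\ forall f, L2 mu f -> ip nu (W f) k = ip mu f v.
  by have [Ws WsP] := choice h; exists Ws.
have [Lk|nLk] := pselect (L2 nu k); last by exists (fun=> 0).
have riesz (j : R -> R[i]) (jL : forall u : mR R -> R, sqint mu u -> L2 mu (j \o u)) :
    (forall a b c, j (c * a + b) = c%:C * j a + j b) -> (forall a, cabs2 (j a) = a ^+ 2) ->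
    exists2 v, sqint mu v & forall u, sqint mu u -> ip nu (W (j \o u)) k = Rint mu (fun x => u x * v x).
  move=> jlin jn; apply: (@sqint_riesz _ _ _ mu (fun u => ip nu (W (j \o u)) k) (`|C| * n2 nu k)).
    move=> c f g sf sg; have Lf := jL _ sf; have Lg := jL _ sg.
    rewrite (_ : j \o _ = (fun x => c%:C * (j \o f) x + (j \o g) x)); last first.
      by apply/funext => x /=.
    have Lc := L2Z c%:C Lf.
    rewrite (@ip_ae _ nu _ (fun x => c%:C * W (j \o f) x + W (j \o g) x)).
    - by rewrite ipDl ?ipZl//; [exact: WL|apply: L2Z; exact: WL|exact: WL].
    - by apply: (WL _ _).1; exact: L2D.
    - by apply: (L2D (L2Z _ (WL _ Lf)) (WL _ Lg)).1.
    - exact: Lk.1.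
    - exact: Wlin.
  move=> f sf; have Lf := jL _ sf; apply: (le_trans (ip_CS (WL _ Lf) Lk)).
  rewrite mulrAC; apply: ler_wpM2r; first exact: n2_ge0.
  apply: (le_trans (Wn _ Lf)).
  rewrite /n2; under eq_fun do rewrite /= jn.
  by apply: ler_wpM2r; [apply: Rint_ge0 => x; exact: sqr_ge0|exact: ler_norm].
have sq0 := sqint0 mu.
have j1L (u : mR R -> R) : sqint mu u -> L2 mu ((fun a : R => a%:C) \o u).
  by move=> su; apply/L2P.
have j2L (u : mR R -> R) : sqint mu u -> L2 mu ((fun a => Complex 0 a) \o u).
  by move=> su; apply/L2P.
have [v1 sv1 v1P] := riesz _ j1L (fun a b c => ltac:(by apply: complex_eq; rewrite !ReImE /=; ring))
  (fun a => ltac:(by rewrite /cabs2 /=; ring)).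
have [v2 sv2 v2P] := riesz _ j2L (fun a b c => ltac:(by apply: complex_eq; rewrite !ReImE /=; ring))
  (fun a => ltac:(by rewrite /cabs2 /=; ring)).
exists (fun x => Complex (v1 x) (v2 x)) => _; split; first exact/L2P.
move=> f Lf; have [s1 s2] := (L2P _ _).1 Lf.
have L1 := j1L _ s1; have L2' := j2L _ s2.
have fE : f = (fun x => 1 * (((fun a : R => a%:C) \o (fun x => Re (f x))) x) + ((fun a => Complex 0 a) \o (fun x => Im (f x))) x).
  by apply/funext => x; apply: complex_eq; rewrite !ReImE /=; ring.
rewrite {1}fE (@ip_ae _ nu _ _ _ _ _ _ (Wlin 1 _ _ L1 L2')).
- rewrite ipDl//; [|exact/L2Z/WL|exact: WL].
  under [X in ip nu X k]eq_fun do rewrite mul1r.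
  rewrite v1P// v2P// -RintD; last 2 first.
  + exact: sqintM.
  + exact: sqintM.
  by [].
- by apply: (WL _ _).1; apply: L2D => //; exact: L2Z.
- by apply: (L2D (L2Z _ (WL _ L1)) (WL _ L2')).1.
- exact: Lk.1.
Qed.

(** * Continuously differentiable functions *)

Section C1_functions.
Context {R : realType}.
Implicit Types f g : R -> R.

(** The derivative is carried as a witness so that product, chain and quotient rules can name it;
    [C1rP] converts to the [derivable] and [derive1] form used in [C1c]. *)
Definition C1r f := exists2 f' : R -> R, (forall x : R, is_derive x (1 : R) f (f' x)) & continuous f'.

Lemma C1rP f : C1r f <-> (forall x : R, derivable f x 1) /\ continuous (derive1 f).
Proof.
split=> [[f' df cf]|[df cf]].
  split=> [x|]; first by have [] := df x.
  by rewrite (_ : derive1 f = f')//; apply/funext => x; rewrite derive1E (@derive_val _ _ _ _ _ _ _ (df x)).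
exists (derive1 f) => // x; rewrite derive1E; exact: DeriveDef.
Qed.

Lemma C1r_continuous f : C1r f -> continuous f.
Proof.
move=> [f' df _] x; apply: differentiable_continuous; apply/derivable1_diffP.
by have [] := df x.
Qed.

Lemma C1r_measurable f : C1r f -> measurable_fun [set: mR R] (f : mR R -> R).
Proof. by move=> /C1r_continuous; exact: continuous_measurable_fun. Qed.

Lemma C1rD f g : C1r f -> C1r g -> C1r (fun x => f x + g x).
Proof.
move=> [f' df cf] [g' dg cg]; exists (fun x => f' x + g' x).
  by move=> x; exact: (is_deriveD (df x) (dg x)).
by move=> x; apply: cvgD; [exact: cf|exact: cg].
Qed.

Lemma C1rM f g : C1r f -> C1r g -> C1r (fun x => f x * g x).
Proof.
move=> Cf Cg; have kf := C1r_continuous Cf; have kg := C1r_continuous Cg.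
move: Cf Cg => [f' df cf] [g' dg cg]; exists (fun x => f x * g' x + g x * f' x).
  by move=> x; exact: (is_deriveM (df x) (dg x)).
by move=> x; apply: cvgD; apply: cvgM; [exact: kf|exact: cg|exact: kg|exact: cf].
Qed.

Lemma C1r_comp f g : C1r f -> C1r g -> C1r (fun x => f (g x)).
Proof.
move=> Cf Cg; have kg := C1r_continuous Cg.
move: Cf Cg => [f' df cf] [g' dg cg]; exists (fun x => f' (g x) * g' x).
  by move=> x; exact: (is_derive1_comp (df (g x)) (dg x)).
move=> x; apply: cvgM; last exact: cg.
by apply: continuous_comp; [exact: kg|exact: cf].
Qed.

Lemma C1rV f : (forall x, f x != 0) -> C1r f -> C1r (fun x => (f x)^-1).
Proof.
move=> f0 Cf; have kf := C1r_continuous Cf.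
move: Cf => [f' df cf]; exists (fun x => - f x ^- 2 * f' x).
  by move=> x; exact: (is_deriveV (f0 x) (df x)).
move=> x; apply: cvgM; last exact: cf.
apply: cvgN; apply: cvgV; first by rewrite expf_neq0.
by rewrite expr2; under eq_fun do rewrite expr2; apply: cvgM; exact: kf.
Qed.

Lemma C1r_cst c : C1r (fun=> c).
Proof. by exists (fun=> 0) => [x|x]; [exact: is_derive_cst|exact: cvg_cst]. Qed.

Lemma C1r_id : C1r (fun x => x).
Proof. by exists (fun=> 1) => [x|x]; [exact: is_derive_id|exact: cvg_cst]. Qed.

Lemma C1rZ c f : C1r f -> C1r (fun x => c * f x).
Proof. by move=> ?; apply: C1rM => //; exact: C1r_cst. Qed.

Lemma C1r_affine a b : C1r (fun x : R => a * x + b).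
Proof. by apply: C1rD; [apply: C1rZ; exact: C1r_id|exact: C1r_cst]. Qed.

Definition sqmax (x : R) := Num.max 0 x ^+ 2.

(** The difference quotient with increment h differs from 2 max(0, x) by at most |h|, on both sides
    of the kink and across it. *)
Lemma C1r_sqmax : C1r sqmax.
Proof.
have le (x h : R) : `|sqmax (h + x) - sqmax x - h * (2 * Num.max 0 x)| <= h ^+ 2.
  rewrite /sqmax ler_norml; apply/andP.
  by case: (leP 0 (h + x)) => ?; case: (leP 0 x) => ?; split; nra.
exists (fun x => 2 * Num.max 0 x); last first.
  move=> x; apply: cvgM; first exact: cvg_cst.
  by apply: (@continuous_max _ _ (fun=> 0) id); [exact: cvg_cst|exact: cvg_id].
move=> x.
have lim : h^-1 *: ((sqmax \o shift x) (h *: 1) - sqmax x) @[h --> 0^'] --> 2 * Num.max 0 x.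
  apply/cvgrPdist_le => e e0; near=> h.
  have h0 : h != 0 by near: h; exact: nbhs_dnbhs_neq.
  have he : `|h| <= e.
    near: h; apply: dnbhs0_le => //.
  apply: le_trans he; rewrite distrC /= [h *: 1]mulr1 -(@ler_pM2l _ `|h|) ?normr_gt0//.
  rewrite -normrM -expr2 real_normK ?num_real//; apply: le_trans (le x h).
  by rewrite le_eqVlt; apply/orP; left; apply/eqP; congr `|_|; rewrite mulrBr mulVKf.
apply: DeriveDef; first by apply/cvg_ex; eexists; exact: lim.
by apply/cvg_lim => //; exact: lim.
Unshelve. all: by end_near.
Qed.

(* A second difference of the C^1 function max(0, x)^2. *)
Definition smoothstep (x : R) := 2 * sqmax x + (- 4 * sqmax (1 * x + - 2^-1) + 2 * sqmax (1 * x + - 1)).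

Lemma C1r_smoothstep : C1r smoothstep.
Proof.
have h b := C1r_comp C1r_sqmax (C1r_affine 1 b).
by apply: C1rD; [|apply: C1rD]; apply: C1rZ => //; exact: C1r_sqmax.
Qed.

Lemma smoothstep0 x : x <= 0 -> smoothstep x = 0.
Proof.
by move=> x0; rewrite /smoothstep /sqmax !max_l; [ring|lra..].
Qed.

Lemma smoothstep1 x : 1 <= x -> smoothstep x = 1.
Proof.
by move=> x0; rewrite /smoothstep /sqmax !max_r; [field|lra..].
Qed.

Lemma smoothstep_itv x : 0 <= smoothstep x <= 1.
Proof.
rewrite /smoothstep /sqmax; case: (leP 0 x); case: (leP 0 (1 * x + - 2^-1));
case: (leP 0 (1 * x + - 1)) => *; apply/andP; split; nra.
Qed.

Lemma C1r_bounded f M : C1r f -> (forall x, M < `|x| -> f x = 0) ->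
  exists B, forall x, `|f x| <= B.
Proof.
move=> Cf fM; have cf := C1r_continuous Cf.
have cn : continuous (fun x => `|f x|).
  by move=> x; apply: continuous_comp; [exact: cf|exact: norm_continuous].
have M0 : - `|M| <= `|M| by have := normr_ge0 M; lra.
have [c _ cP] := EVT_max M0 (continuous_subspaceT cn).
exists `|f c| => x; have [xM|xM] := leP `|x| `|M|.
  by apply: cP; rewrite in_itv/= -ler_norml.
by rewrite (fM x) ?normr0// (le_lt_trans (ler_norm M)).
Qed.

Definition cutoff n x : R := smoothstep (1 * x + n.+1%:R) * smoothstep (-1 * x + n.+1%:R).

Lemma C1r_cutoff n : C1r (cutoff n).
Proof. by apply: C1rM; apply: (C1r_comp C1r_smoothstep); exact: C1r_affine. Qed.

Lemma cutoff_itv n x : 0 <= cutoff n x <= 1.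
Proof.
rewrite /cutoff; have /andP[a0 a1] := smoothstep_itv (1 * x + n.+1%:R).
have /andP[b0 b1] := smoothstep_itv (-1 * x + n.+1%:R).
by rewrite mulr_ge0// mulr_ile1.
Qed.

Lemma cutoff1 n x : `|x| <= n%:R -> cutoff n x = 1.
Proof.
rewrite ler_norml => /andP[h1 h2]; rewrite /cutoff !smoothstep1 ?mulr1//;
  by rewrite -natr1; lra.
Qed.

Lemma cutoff0 n x : n.+1%:R < `|x| -> cutoff n x = 0.
Proof.
rewrite ltr_normr => /orP[] h; rewrite /cutoff.
  by rewrite [X in _ * X]smoothstep0 ?mulr0//; lra.
by rewrite smoothstep0 ?mul0r//; lra.
Qed.

Lemma cvg_cutoff x : cutoff n x @[n --> \oo] --> (1 : R).
Proof.
apply: cvg_near_cst; near=> n; apply: cutoff1; near: n.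
exact: nbhs_infty_ger.
Unshelve. all: by end_near.
Qed.

End C1_functions.

Section C1c_functions.
Context {R : realType}.
Implicit Types f g : R -> R[i].

Lemma C1cP f : C1c f <-> [/\ exists M, forall x, M < `|x| -> f x = 0,
  C1r (fun x => Re (f x)) & C1r (fun x => Im (f x))].
Proof.
split=> [[M [df [c1 c2]]]|[M C1 C2]].
  split; first exact: M.
    by apply: (C1rP _).2; split=> [x|]; [exact: (df x).1|exact: c1].
  by apply: (C1rP _).2; split=> [x|]; [exact: (df x).2|exact: c2].
have [d1 c1] := (C1rP _).1 C1; have [d2 c2] := (C1rP _).1 C2.
exact: (conj M (conj (fun x => conj (d1 x) (d2 x)) (conj c1 c2))).
Qed.

Lemma C1cM (u f : R -> R[i]) : C1r (fun x => Re (u x)) -> C1r (fun x => Im (u x)) ->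
  C1c f -> C1c (fun x => u x * f x).
Proof.
move=> u1 u2 /C1cP[[M fM] f1 f2]; apply/C1cP; split.
- by exists M => x /fM ->; rewrite mulr0.
- rewrite (_ : (fun x => Re (u x * f x)) = (fun x => Re (u x) * Re (f x) + -1 * (Im (u x) * Im (f x)))).
    by apply: C1rD; [|apply: C1rZ]; apply: C1rM.
  by apply/funext => x; rewrite cReM mulN1r.
- rewrite (_ : (fun x => Im (u x * f x)) = (fun x => Re (u x) * Im (f x) + Im (u x) * Re (f x))).
    by apply: C1rD; apply: C1rM.
  by apply/funext => x; rewrite cImM.
Qed.

Lemma C1c_cutoff n : C1c (fun x : R => (cutoff n x)%:C).
Proof.
apply/C1cP; split; last exact: C1r_cst.
- by exists n.+1%:R => x /cutoff0 ->.
- exact: C1r_cutoff.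
Qed.

Lemma C1c_measurable f : C1c f -> cmeasurable f.
Proof. by move=> /C1cP[_ f1 f2]; split; exact: C1r_measurable. Qed.

Lemma C1c_bounded f : C1c f -> exists B, forall x, cabs2 (f x) <= B.
Proof.
move=> /C1cP[[M fM] f1 f2].
have [x /fM ->//|B1 hB1] := C1r_bounded (M := M) f1.
have [x /fM ->//|B2 hB2] := C1r_bounded (M := M) f2.
exists (B1 ^+ 2 + B2 ^+ 2) => x; rewrite /cabs2 lerD//.
  by rewrite -(real_normK (num_real (Re _))) lerXn2r ?nnegrE// (le_trans _ (hB1 x)).
by rewrite -(real_normK (num_real (Im _))) lerXn2r ?nnegrE// (le_trans _ (hB2 x)).
Qed.

End C1c_functions.

(** * The Cauchy kernel and the operator V *)

Section complex_integral.
Context {R : realType} (mu : bmeasure R).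
Implicit Types f g : R -> R[i].

Definition cintg f :=
  intg mu (fun x : mR R => Re (f x)) /\ intg mu (fun x : mR R => Im (f x)).

Lemma cintZ c f : cintg f -> cint mu (fun x => c * f x) = c * cint mu f.
Proof.
move=> [i1 i2]; apply: complex_eq; rewrite !ReImE /=.
  rewrite -(RintZ _ i1) -(RintZ _ i2) -(RintB (intgZ _ i1) (intgZ _ i2)).
  by congr (Rint mu); apply/funext => x; rewrite !ReImE.
rewrite -(RintZ _ i1) -(RintZ _ i2) -(RintD (intgZ _ i2) (intgZ _ i1)).
by congr (Rint mu); apply/funext => x; rewrite !ReImE.
Qed.

Lemma cintB f g : cintg f -> cintg g -> cint mu (fun x => f x - g x) = cint mu f - cint mu g.
Proof.
move=> [f1 f2] [g1 g2]; apply: complex_eq; rewrite !ReImE /=.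
  by rewrite -(RintB f1 g1); congr (Rint mu); apply/funext => x; rewrite !ReImE.
by rewrite -(RintB f2 g2); congr (Rint mu); apply/funext => x; rewrite !ReImE.
Qed.

Lemma cintg_mul f g : L2 mu f -> L2 mu g -> cintg (fun x => f x * g x).
Proof.
move=> /L2P[f1 f2] /L2P[g1 g2]; split.
  by under eq_fun do rewrite cReM; apply: intgB; exact: sqintM.
by under eq_fun do rewrite cImM; apply: intgD; exact: sqintM.
Qed.

Lemma ip_cint f g : ip mu f g = Re (cint mu (fun x => f x * conjc (g x))).
Proof. by congr (Rint mu); apply/funext => x; rewrite !ReImE; ring. Qed.

End complex_integral.

Section complex_limits.
Context {R : realType}.
Implicit Types (u v : nat -> R[i]) (a b : R[i]).

Definition ccvg u a :=
  (Re (u n) @[n --> \oo] --> Re a) /\ (Im (u n) @[n --> \oo] --> Im a).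

Lemma ccvg_cst a : ccvg (fun=> a) a.
Proof. by split; exact: cvg_cst. Qed.

Lemma ccvgD u v a b : ccvg u a -> ccvg v b -> ccvg (fun n => u n + v n) (a + b).
Proof.
move=> [u1 u2] [v1 v2]; split; rewrite !ReImE.
  by under eq_cvg do rewrite cReD; exact: cvgD.
by under eq_cvg do rewrite cImD; exact: cvgD.
Qed.

Lemma ccvgM u v a b : ccvg u a -> ccvg v b -> ccvg (fun n => u n * v n) (a * b).
Proof.
move=> [u1 u2] [v1 v2]; split; rewrite !ReImE.
  by under eq_cvg do rewrite cReM; apply: cvgB; exact: cvgM.
by under eq_cvg do rewrite cImM; apply: cvgD; exact: cvgM.
Qed.

Lemma ccvgB u v a b : ccvg u a -> ccvg v b -> ccvg (fun n => u n - v n) (a - b).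
Proof.
move=> [u1 u2] [v1 v2]; split; rewrite !ReImE.
  by under eq_cvg do rewrite cReD cReN; exact: cvgB.
by under eq_cvg do rewrite cImD cImN; exact: cvgB.
Qed.

Lemma ccvg_cabs2 u a : ccvg u a -> cabs2 (u n) @[n --> \oo] --> cabs2 a.
Proof.
move=> [u1 u2]; rewrite /cabs2 !expr2; under eq_cvg do rewrite !expr2.
by apply: cvgD; exact: cvgM.
Qed.

End complex_limits.

(** * The kernel 1/(t - z) and its difference quotients *)

Section resolvent_kernel.
Context {R : realType}.
Implicit Types (z : R[i]) (f : R -> R[i]).

Definition rz z (t : R) : R[i] := (t%:C - z)^-1.
Definition rzden z (t : R) : R := (t - Re z) ^+ 2 + Im z ^+ 2.

Lemma rzden_gt0 z t : Im z != 0 -> 0 < rzden z t.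
Proof. by move=> z0; rewrite ltr_wpDl ?sqr_ge0// exprn_even_gt0. Qed.

Lemma cabs2_sub z t : cabs2 (t%:C - z) = rzden z t.
Proof. by rewrite /cabs2 /rzden !ReImE /= sub0r sqrrN. Qed.

Lemma subz_neq0 z (t : R) : Im z != 0 -> t%:C - z != 0.
Proof.
move=> z0; apply/eqP => h; have := rzden_gt0 t z0.
by rewrite -cabs2_sub h /cabs2 /= expr0n/= addr0 ltxx.
Qed.

Lemma Re_rz z t : Re (rz z t) = (t - Re z) / rzden z t.
Proof. by rewrite cReV cabs2_sub !ReImE. Qed.

Lemma Im_rz z t : Im (rz z t) = Im z / rzden z t.
Proof. by rewrite cImV cabs2_sub !ReImE /= sub0r mulNr opprK. Qed.

Lemma cabs2_rz z t : cabs2 (rz z t) = (rzden z t)^-1.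
Proof. by rewrite cabs2V cabs2_sub. Qed.

Lemma rzJ z t : rz (conjc z) t = conjc (rz z t).
Proof.
by apply: complex_eq; rewrite !ReImE ?Re_rz ?Im_rz /rzden !ReImE sqrrN ?mulNr.
Qed.

Lemma C1r_rz z : Im z != 0 -> C1r (fun t => Re (rz z t)) /\ C1r (fun t => Im (rz z t)).
Proof.
move=> z0.
have aff : C1r (fun t => t - Re z) by apply: C1rD; [exact: C1r_id|exact: C1r_cst].
have inv : C1r (fun t => (rzden z t)^-1).
  apply: C1rV; first by move=> t; rewrite gt_eqF// rzden_gt0.
  by apply: C1rD; [apply: C1rM|exact: C1r_cst].
split.
  by under eq_fun do rewrite Re_rz; exact: C1rM.
by under eq_fun do rewrite Im_rz; exact: C1rZ.
Qed.

Lemma rz_measurable z : Im z != 0 -> cmeasurable (rz z).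
Proof. by move=> /C1r_rz[? ?]; split; exact: C1r_measurable. Qed.

Lemma cabs2_rz_le z t : Im z != 0 -> cabs2 (rz z t) <= (Im z ^+ 2)^-1.
Proof.
move=> z0; have y0 : 0 < Im z ^+ 2 by rewrite exprn_even_gt0.
by rewrite cabs2_rz lef_pV2 ?posrE ?rzden_gt0// lerDr sqr_ge0.
Qed.

(** This is the decay matched to the integrability assumption on mu: it puts r_z in both L^1(mu) and
    L^2(mu). *)
Lemma cabs2_rz_decay z : Im z != 0 ->
  exists2 K, 0 <= K & forall t, cabs2 (rz z t) <= (K * (1 + `|t|)^-1) ^+ 2.
Proof.
move=> z0; have y0 : 0 < Im z ^+ 2 by rewrite exprn_even_gt0.
(* Chosen so that c |t - z|^2 dominates 2 (t - Re z)^2 + 2 (1 + |Re z|)^2, which in turn dominates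
   (1 + |t|)^2. *)
pose c := 2 + 2 * (1 + `|Re z|) ^+ 2 / Im z ^+ 2.
have c0 : 0 <= c by rewrite /c addr_ge0// mulr_ge0 ?invr_ge0 ?(ltW y0)// mulr_ge0// sqr_ge0.
exists (Num.sqrt c); first exact: sqrtr_ge0.
move=> t; have t1 : 0 < 1 + `|t| by have := normr_ge0 t; lra.
rewrite cabs2_rz exprMn sqr_sqrtr// exprVn ler_pdivlMr ?exprn_gt0//.
rewrite mulrC ler_pdivrMr ?rzden_gt0// /rzden /c.
rewrite (_ : _ * _ = 2 * (t - Re z) ^+ 2 + 2 * Im z ^+ 2 +
  2 * (1 + `|Re z|) ^+ 2 * ((t - Re z) ^+ 2 / Im z ^+ 2) + 2 * (1 + `|Re z|) ^+ 2); last by field.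
have h0 : 0 <= 2 * (1 + `|Re z|) ^+ 2 * ((t - Re z) ^+ 2 / Im z ^+ 2).
  by apply: mulr_ge0; [apply: mulr_ge0; rewrite ?sqr_ge0|apply: divr_ge0; rewrite sqr_ge0].
have : (1 + `|t|) ^+ 2 <= 2 * (t - Re z) ^+ 2 + 2 * (1 + `|Re z|) ^+ 2.
  rewrite -(real_normK (num_real (t - Re z))).
  have := ler_normD (t - Re z) (Re z); rewrite subrK.
  have := normr_ge0 t; have := normr_ge0 (Re z); have := normr_ge0 (t - Re z).
  set a := `|t|; set b := `|_ - _|; set d := `|Re z| => b0 d0 a0 h.
  have : (1 + a) ^+ 2 <= (b + (1 + d)) ^+ 2 by rewrite lerXn2r ?nnegrE; lra.
  by have := sqr_ge0 (b - (1 + d)); lra.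
by lra.
Qed.

Lemma C1c_rz z f : Im z != 0 -> C1c f -> C1c (fun t => rz z t * f t).
Proof. by move=> /C1r_rz[? ?]; exact: C1cM. Qed.

Lemma C1c_is_derive f (s : R) : C1c f ->
  is_derive s (1 : R) (fun y => Re (f y)) (Re (cderiv f s)) /\
  is_derive s (1 : R) (fun y => Im (f y)) (Im (cderiv f s)).
Proof.
move=> [_ [df _]]; have [d1 d2] := df s; rewrite /cderiv /= !derive1E.
by split; [exact: (DeriveDef d1 erefl)|exact: (DeriveDef d2 erefl)].
Qed.

(* Differentiate f = (t - z) (f / (t - z)) instead of the quotient. *)
Lemma cderiv_rz z f s : Im z != 0 -> C1c f ->
  cderiv (fun t => rz z t * f t) s = rz z s * (cderiv f s - rz z s * f s).
Proof.
move=> z0 Cf; set g := fun t => rz z t * f t.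
have Cg : C1c g by exact: C1c_rz.
have fE t : f t = (t%:C - z) * g t by rewrite /g mulVKf// subz_neq0.
have [f1 f2] := C1c_is_derive s Cf; have [g1 g2] := C1c_is_derive s Cg.
have daff : is_derive s (1 : R) (fun t : R => t - Re z) 1.
  by apply: is_derive_eq; rewrite subr0.
have e1 : Re (cderiv f s) = Re (g s) + (s - Re z) * Re (cderiv g s) + Im z * Im (cderiv g s).
  rewrite -(@derive_val _ _ _ _ _ _ _ f1).
  rewrite (_ : (fun y => Re (f y)) = (fun t => (t - Re z) * Re (g t) + Im z * Im (g t))).
    have h := is_deriveD (is_deriveM daff g1) (is_deriveZ (Im z) g2).
    by rewrite (@derive_val _ _ _ _ _ _ _ h) /GRing.scale /=; ring.
  by apply/funext => t; rewrite fE !ReImE /=; ring.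
have e2 : Im (cderiv f s) = Im (g s) + (s - Re z) * Im (cderiv g s) - Im z * Re (cderiv g s).
  rewrite -(@derive_val _ _ _ _ _ _ _ f2).
  rewrite (_ : (fun y => Im (f y)) = (fun t => (t - Re z) * Im (g t) + - Im z * Re (g t))).
    have h := is_deriveD (is_deriveM daff g2) (is_deriveZ (- Im z) g1).
    by rewrite (@derive_val _ _ _ _ _ _ _ h) /GRing.scale /=; ring.
  by apply/funext => t; rewrite fE !ReImE /=; ring.
have -> : cderiv f s = g s + (s%:C - z) * cderiv g s.
  by apply: complex_eq; rewrite ?e1 ?e2 !ReImE /=; ring.
by rewrite -[rz z s * f s]/(g s) [g s + _]addrC addrK mulKf// subz_neq0.
Qed.

(** Off the diagonal this is the resolvent identity r_z(s) - r_z(t) = - (s - t) r_z(s) r_z(t); on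
    the diagonal it is the product rule. *)
Lemma dquot_rz z f s t : Im z != 0 -> C1c f ->
  dquot (fun t => rz z t * f t) s t = rz z s * (dquot f s t - rz z t * f t).
Proof.
move=> z0 Cf; rewrite /dquot; case: eqVneq => [->|ts]; first exact: cderiv_rz.
have st0 : (s - t)%:C != 0.
  by apply/eqP => -[/eqP]; rewrite subr_eq0 eq_sym (negbTE ts).
have e : (s - t)%:C = (s%:C - z) - (t%:C - z).
  by apply: complex_eq; rewrite !ReImE /=; ring.
have s0 := subz_neq0 s z0; have t0 := subz_neq0 t z0.
rewrite /rz; move: st0; rewrite e; move: s0 t0.
set a := s%:C - z; set b := t%:C - z => a0 b0 ab0.
by field; rewrite ?a0 ?b0 ?ab0.
Qed.

End resolvent_kernel.

Section V_on_C1c.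
Context {R : realType} (mu : bmeasure R) (alpha : R).
Hypothesis hmu : (\int[mu]_(t in [set: mR R]) ((1 + `|(t : R)|)^-1)%:E < +oo)%E.
Implicit Types (z : R[i]) (f : R -> R[i]).

Let w (t : mR R) : R := (1 + `|t|)^-1.

Lemma decay_gt0 (t : R) : 0 < (1 + `|t|)^-1.
Proof. by rewrite invr_gt0; have := normr_ge0 t; lra. Qed.

Lemma decay_intg : intg mu w.
Proof.
apply: ge0_intg => //; last by move=> x; rewrite ltW// decay_gt0.
apply: continuous_measurable_fun => x; apply: cvgV; first by have := normr_ge0 x; lra.
by apply: cvgD; [exact: cvg_cst|exact: norm_continuous].
Qed.

Lemma intg_decay (g : mR R -> R) K : measurable_fun [set: mR R] g ->
  (forall t, `|g t| <= K * (1 + `|t|)^-1) -> intg mu g.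
Proof. by move=> mg gK; exact: (intg_le mg (intgZ K decay_intg)). Qed.

Lemma cabs2_le (a : R[i]) K : 0 <= K -> cabs2 a <= K ^+ 2 -> `|Re a| <= K /\ `|Im a| <= K.
Proof.
move=> K0; rewrite /cabs2 => h; have := sqr_ge0 (Re a); have := sqr_ge0 (Im a) => h1 h2.
by split; rewrite -(@ler_pXn2r _ 2) ?nnegrE// real_normK ?num_real//; lra.
Qed.

Lemma rz_cintg z : Im z != 0 -> cintg mu (rz z).
Proof.
move=> z0; have [m1 m2] := rz_measurable z0; have [K K0 KP] := cabs2_rz_decay z0.
have h t : `|Re (rz z t)| <= K * (1 + `|t|)^-1 /\ `|Im (rz z t)| <= K * (1 + `|t|)^-1.
  by apply: cabs2_le (KP t); rewrite mulr_ge0// ltW// decay_gt0.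
by split; apply: (intg_decay (K := K)) => // t; have [] := h t.
Qed.

Lemma rz_L2 z : Im z != 0 -> L2 mu (rz z).
Proof.
move=> z0; have mz := rz_measurable z0; have [K K0 KP] := cabs2_rz_decay z0.
split => //; rewrite (@RintE _ _ _ mu (fun x => cabs2 (rz z x))) ?ltry//.
apply: (intg_decay (K := K ^+ 2)); first exact: cmeasurable_cabs2.
move=> t; rewrite ger0_norm ?cabs2_ge0// (le_trans (KP t))// exprMn.
apply: ler_wpM2l; first exact: sqr_ge0.
have t1 : 1 <= 1 + `|t| by have := normr_ge0 t; lra.
by rewrite expr2 ger_pMl ?decay_gt0// invf_le1//; lra.
Qed.

Lemma C1c_decay f : C1c f -> exists2 K, 0 <= K & forall t, cabs2 (f t) <= (K * (1 + `|t|)^-1) ^+ 2.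
Proof.
move=> Cf; have [[M fM] _ _] := (C1cP f).1 Cf; have [B hB] := C1c_bounded Cf.
have B0 : 0 <= B by exact: le_trans (cabs2_ge0 _) (hB 0).
exists (Num.sqrt B * (1 + `|M|)); first by rewrite mulr_ge0 ?sqrtr_ge0//; have := normr_ge0 M; lra.
move=> t; have [tM|tM] := leP `|t| `|M|; last first.
  by rewrite fM ?(le_lt_trans (ler_norm M))// /cabs2/= expr0n addr0 sqr_ge0.
apply: (le_trans (hB t)); rewrite -mulrA exprMn sqr_sqrtr// ler_peMr//.
apply: exprn_ege1; rewrite ler_pdivlMr ?mul1r ?lerD2l//.
Qed.

Lemma C1c_L2 f : C1c f -> L2 mu f.
Proof.
move=> Cf; have mf := C1c_measurable Cf; have [K K0 KP] := C1c_decay Cf.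
split => //; rewrite (@RintE _ _ _ mu (fun x => cabs2 (f x))) ?ltry//.
apply: (intg_decay (K := K ^+ 2)); first exact: cmeasurable_cabs2.
move=> t; rewrite ger0_norm ?cabs2_ge0// (le_trans (KP t))// exprMn.
apply: ler_wpM2l; first exact: sqr_ge0.
have t1 : 1 <= 1 + `|t| by have := normr_ge0 t; lra.
by rewrite expr2 ger_pMl ?decay_gt0// invf_le1//; lra.
Qed.

Definition dquotr (f : R -> R) (s t : R) : R :=
  if t == s then derive1 f s else (f s - f t) / (s - t).

Lemma dquot_dquotr f s t : dquot f s t =
  Complex (dquotr (fun y => Re (f y)) s t) (dquotr (fun y => Im (f y)) s t).
Proof.
rewrite /dquot /dquotr; case: eqVneq => [//|ts].
have st : s - t != 0 by rewrite subr_eq0 eq_sym.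
apply: complex_eq; rewrite !ReImE cReV cImV /cabs2 /= expr0n/= addr0; field.
all: by rewrite ?st.
Qed.

Lemma dquotr_measurable (f : R -> R) s : C1r f ->
  measurable_fun [set: mR R] (dquotr f s : mR R -> R).
Proof.
move=> Cf; apply: measurable_fun_ifT => //.
- by apply: measurable_fun_eqr => //; exact: measurable_cst.
- apply: measurable_funM.
    by apply: measurable_funB => //; exact: C1r_measurable.
  have m0 : measurable [set s : mR R] by exact: measurable_set1.
  rewrite -(setUv [set s]); apply/measurable_funU => //; first exact: measurableC.
  split; first exact: measurable_fun_set1.
  have oc : open (~` [set s] : set R) by apply: closed_openC; exact: closed_eq.
  apply: (@open_continuous_measurable_fun R (~` [set s]) (fun t => (s - t)^-1) oc).
  move=> t; rewrite inE /= => ts; apply: cvgV; first by rewrite subr_eq0; apply/eqP => h; apply: ts.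
  by apply: cvgB; [exact: cvg_cst|exact: cvg_id].
Qed.

(** Within a distance d of s differentiability bounds the quotient by |f'(s)| + 1. Beyond d it is at
    most 2 B / |s - t|, where 1 + |t| <= ((1 + |s|) / d + 1) |s - t|. The constant [K] adds the two
    bounds. *)
Lemma dquotr_intg (f : R -> R) s M : C1r f -> (forall x, M < `|x| -> f x = 0) ->
  intg mu (dquotr f s : mR R -> R).
Proof.
move=> Cf fM; have [B hB] := C1r_bounded Cf fM.
have B0 : 0 <= B by exact: le_trans (normr_ge0 _) (hB 0).
have [d d0 dP] : exists2 d, 0 < d & forall t, `|t - s| < d -> `|dquotr f s t| <= `|derive1 f s| + 1.
  have [df _] := (C1rP f).1 Cf.
  have [f' dfs _] := Cf.
  have /cvgrPdist_le/(_ 1 ltr01) : h^-1 *: ((f \o shift s) (h *: 1) - f s) @[h --> 0^'] --> derive1 f s.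
    by rewrite derive1E; exact: df.
  rewrite near_withinE /= => /nbhs_ballP[d /= d0 dP]; exists d => // t ts.
  rewrite /dquotr; case: eqVneq => [_|tns]; first by lra.
  have ts0 : t - s != 0 by rewrite subr_eq0.
  have := dP (t - s); rewrite -ball_normE /= sub0r normrN => /(_ ts ts0).
  rewrite [_ *: 1]mulr1 subrK /GRing.scale /= => h.
  have -> : (f s - f t) / (s - t) = (t - s)^-1 * (f t - f s).
    by rewrite -(opprB t) -(opprB (f t)) invrN mulrNN mulrC.
  have := ler_normB (derive1 f s) (derive1 f s - (t - s)^-1 * (f t - f s)).
  by rewrite opprB addrC subrK; lra.
pose K := (`|derive1 f s| + 1) * (1 + d + `|s|) + 2 * B * ((1 + `|s|) / d + 1).
apply: (intg_decay (K := K)); first exact: dquotr_measurable.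
move=> t; have s0 := normr_ge0 s; have t0 := normr_ge0 t; have e0 := normr_ge0 (derive1 f s).
have ts0 := normr_ge0 (t - s).
have tst : `|t| <= `|t - s| + `|s| by have := ler_normD (t - s) s; rewrite subrK.
have q0 : 0 <= (1 + `|s|) / d by rewrite divr_ge0//; lra.
rewrite ler_pdivlMr; last by lra.
have [ds|ds] := ltP `|t - s| d.
  apply: (@le_trans _ _ ((`|derive1 f s| + 1) * (1 + d + `|s|))).
    by apply: ler_pM; rewrite ?normr_ge0 ?dP//; lra.
  by rewrite /K lerDl !mulr_ge0//; lra.
have tsp : 0 < `|t - s| by lra.
apply: (@le_trans _ _ (2 * B * ((1 + `|s|) / d + 1))); last first.
  by rewrite /K lerDr mulr_ge0//; lra.
have -> : dquotr f s t = (f s - f t) / (s - t).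
  by rewrite /dquotr; case: eqVneq => // ts; move: tsp; rewrite ts subrr normr0 ltxx.
rewrite normrM normfV.
apply: (@le_trans _ _ (2 * B * (`|s - t|^-1 * (1 + `|t|)))).
  rewrite -[leLHS]mulrA; apply: ler_wpM2r; first by rewrite mulr_ge0 ?invr_ge0//; lra.
  by rewrite (le_trans (ler_normB _ _))//; have := hB s; have := hB t; lra.
apply: ler_wpM2l; first by lra.
rewrite distrC mulrC ler_pdivrMr// mulrDl mul1r.
have : 1 + `|s| <= (1 + `|s|) / d * `|t - s|.
  by rewrite -mulrA ler_peMr ?ler_pdivlMl ?mulr1//; lra.
by lra.
Qed.

End V_on_C1c.

Section V_identities.
Context {R : realType} (mu : bmeasure R) (alpha : R).
Hypothesis hmu : (\int[mu]_(t in [set: mR R]) ((1 + `|(t : R)|)^-1)%:E < +oo)%E.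
Implicit Types (z : R[i]) (f : R -> R[i]).

Lemma dquot_cintg f s : C1c f -> cintg mu (fun t => dquot f s t).
Proof.
move=> /C1cP[[M fM] f1 f2]; split.
  under eq_fun do rewrite dquot_dquotr /=.
  by apply: (dquotr_intg hmu s (M := M)) => // x /fM ->.
under eq_fun do rewrite dquot_dquotr /=.
by apply: (dquotr_intg hmu s (M := M)) => // x /fM ->.
Qed.

(** Integrate [dquot_rz] in t: the term r_z(s) r_z(t) f(t) becomes the rank one correction. *)
Lemma Vop_rz z f s : Im z != 0 -> C1c f ->
  Vop mu alpha (fun t => rz z t * f t) s =
  rz z s * (Vop mu alpha f s + alpha%:C * cint mu (fun u => rz z u * f u)).
Proof.
move=> z0 Cf; rewrite /Vop.
have i1 := dquot_cintg s Cf.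
have i2 : cintg mu (fun u => rz z u * f u).
  by apply: cintg_mul; [exact: rz_L2|exact: C1c_L2].
rewrite (_ : (fun t => dquot _ s t) = (fun t => rz z s * (dquot f s t - rz z t * f t))); last first.
  by apply/funext => t; exact: dquot_rz.
rewrite cintZ ?cintB//; first by ring.
have [[a1 a2] [b1 b2]] := (i1, i2); split.
  by under eq_fun do rewrite cReD cReN; exact: intgB.
by under eq_fun do rewrite cImD cImN; exact: intgB.
Qed.

(** A rigorous form of V 1 = 1. The difference quotient at s of the n-th cutoff vanishes for |t| <=
    n once n is large, and for larger |t| it is dominated by a multiple of (1 + |t|)^-1. *)
Lemma cvg_Vop_cutoff s :
  ccvg (fun n => Vop mu alpha (fun t => (cutoff n t)%:C) s) 1.
Proof.
pose D n t := dquotr (@cutoff R n) s t.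
have ID0 : Rint mu (fun t : mR R => D n t) @[n --> \oo] --> (0 : R).
  (* The threshold 2 |s| + 1 keeps the unit neighbourhood of s inside [-n, n], which settles t = s,
     and makes |s - t| comparable to 1 + |t| when |t| > n. *)
  have far n t : 2 * `|s| + 1 <= n%:R -> `|t| <= n%:R -> D n t = 0.
    move=> sn tn; rewrite /D /dquotr; case: eqVneq => [_|ts]; last first.
      by rewrite !cutoff1 ?subrr ?mul0r//; have := normr_ge0 s; lra.
    rewrite derive1E -(derive_cst (1 : R) s (1 : R)); apply: near_eq_derive.
    near=> x; apply: cutoff1.
    have : `|s - x| <= 1 by near: x; apply: (@cvgr_dist_le _ _ _ _ _ id s) => //; exact: cvg_id.
    rewrite distrC; by have := ler_normD (x - s) s; rewrite subrK; have := normr_ge0 s; lra.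
  have [N _ NP] := nbhs_infty_ger (2 * `|s| + 1).
  have HN n : 2 * `|s| + 1 <= (n + N)%:R by apply: NP => /=; exact: leq_addl.
  (* Shifting past the threshold makes the domination hold for every index. *)
  rewrite -(cvg_shiftn N).
  suff : Rint mu (fun t : mR R => D (n + N)%N t) @[n --> \oo] --> Rint mu (fun=> 0) by rewrite Rint0.
  apply: (@Rint_dct _ _ _ mu (fun n t => D (n + N)%N t) (fun=> 0) (fun t : mR R => 4 * (1 + `|t|)^-1)).
  - by move=> n; apply: dquotr_measurable; exact: C1r_cutoff.
  - exact: measurable_cst.
  - by apply: intgZ; exact: decay_intg.
  - apply: nearW => t; apply: cvg_near_cst; near=> n; apply: far; first exact: HN.
    rewrite natrD (@le_trans _ _ n%:R) ?lerDl//; near: n; exact: nbhs_infty_ger.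
  move=> n t /=; have Hn := HN n; set k := (n + _)%N in Hn *.
  have [tk|tk] := leP `|t| k%:R.
    by rewrite far// normr0 mulr_ge0// ltW// decay_gt0.
  have s0 := normr_ge0 s.
  rewrite /D /dquotr; case: eqVneq => [ts|ts]; first by move: tk; rewrite ts; lra.
  have h1 : `|t| - `|s| <= `|s - t| by rewrite distrC lerB_dist.
  rewrite normrM normfV cutoff1; last by lra.
  have /andP[c0 c1] := cutoff_itv k t.
  rewrite ger0_norm; last by lra.
  rewrite ler_pdivrMr; last by lra.
  rewrite mulrAC ler_pdivlMr; last by lra.
  by nra.
have -> : (fun n => Vop mu alpha (fun t => (cutoff n t)%:C) s) =
    (fun n => (cutoff n s)%:C + - alpha%:C * (Rint mu (fun t : mR R => D n t))%:C).
  apply/funext => n; rewrite /Vop mulNr; congr (_ - _ * _).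
  apply: complex_eq => /=.
    by congr (Rint mu); apply/funext => t; rewrite dquot_dquotr.
  rewrite -[RHS](Rint0 mu); congr (Rint mu); apply/funext => t; rewrite dquot_dquotr /= /dquotr.
  by rewrite derive1_cst subrr mul0r if_same.
rewrite -[X in ccvg _ X]addr0 -(mulr0 (- alpha%:C)).
apply: ccvgD; first by split => /=; [exact: cvg_cutoff|exact: cvg_cst].
apply: ccvgM; first exact: ccvg_cst.
by split => //=; exact: cvg_cst.
Unshelve. all: by end_near.
Qed.

(** The functions smoothstep(k (x - a)) converge everywhere to the indicator of the open ray from a,
    being 0 at a itself. Multiplied by a cutoff they are admissible tests, and the product of the
    cutoff with p is integrable, so [ray_integral_ae0] applies to it. *)
Lemma test_functions_ae0 (p : mR R -> R) : sqint mu p ->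
  (forall g M, C1r g -> (forall x, M < `|x| -> g x = 0) -> Rint mu (fun x : mR R => g x * p x) = 0) ->
  {ae mu, forall x, p x = 0}.
Proof.
move=> sp gp.
have scut n : sqint mu (@cutoff R n : mR R -> R).
  by have /L2P[] := C1c_L2 hmu (C1c_cutoff n).
have Ci n (a b : R) : C1r (fun x => cutoff n x * smoothstep (a * x + b)).
  by apply: C1rM; [exact: C1r_cutoff|apply: (C1r_comp C1r_smoothstep); exact: C1r_affine].
have pn n : {ae mu, forall x, cutoff n x * p x = 0}.
  have ci := sqintM (scut n) sp.
  apply: (@ray_integral_ae0 R mu (fun x => cutoff n x * p x) ci).
    by apply: (gp _ n.+1%:R) => [|x]; [exact: C1r_cutoff|exact: cutoff0].
  move=> a.
  have : Rint mu (fun x : mR R => (cutoff n x * smoothstep (k%:R * x + - (k%:R * a))) * p x) @[k --> \oo]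
     --> Rint mu (fun x : mR R => cutoff n x * p x * \1_(`]a, +oo[%classic) x).
    apply: (Rint_dct (g := fun x : mR R => `|cutoff n x * p x|)).
    - by move=> k; apply: measurable_funM; [exact: C1r_measurable (Ci _ _ _)|exact: sp.1].
    - by apply: measurable_funM; [exact: intg_meas ci|exact: measurable_indic].
    - exact: (integrable_norm ci).
    - apply: nearW => x; apply: cvg_near_cst; near=> k.
      rewrite indicE; have [ax|xa] := ltP a x.
        rewrite mem_set; last by rewrite /= in_itv/= ax.
        rewrite smoothstep1 ?mulr1// -mulrBr.
        have : (x - a)^-1 <= k%:R by near: k; exact: nbhs_infty_ger.
        have xa0 : 0 < x - a by lra.
        by rewrite -ler_pdivrMr// mul1r.
      rewrite memNset; last by rewrite /= in_itv/= ltNge xa.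
      rewrite smoothstep0 ?mulr0 ?mul0r// -mulrBr.
      by apply: mulr_ge0_le0 => //; lra.
    - move=> k x; rewrite mulrAC normrM ler_piMr//.
      by have /andP[] := smoothstep_itv (k%:R * x + - (k%:R * a)) => h0 h1; rewrite ger0_norm.
  rewrite (_ : (fun k => _) = fun=> 0); last first.
    apply/funext => k; apply: (gp _ n.+1%:R (Ci _ _ _)) => x /cutoff0 ->; exact: mul0r.
  by move=> h; apply/esym; apply: (cvg_unique _ (cvg_cst 0) h).
apply: filterS (ae_foralln pn) => x h.
have [n _ nP] := nbhs_infty_ger `|x|.
by have := h n; rewrite cutoff1 ?mul1r//; apply: nP => /=.
Unshelve. all: by end_near.
Qed.

(** Density of C^1 functions in dual form; real and purely imaginary test functions isolate the two
    components of v. *)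
Lemma C1c_perp_ae0 v : L2 mu v -> (forall f, C1c f -> ip mu f v = 0) -> aeq mu v (fun=> 0).
Proof.
move=> /L2P[v1 v2] vf.
have h1 : {ae mu, forall x : mR R, Re (v x) = 0}.
  apply: test_functions_ae0 => // g M Cg gM.
  rewrite -[RHS](vf (fun x => (g x)%:C)); last first.
    by apply/C1cP; split; [exists M => x /gM ->|exact: Cg|exact: C1r_cst].
  by congr (Rint mu); apply/funext => x /=; ring.
have h2 : {ae mu, forall x : mR R, Im (v x) = 0}.
  apply: test_functions_ae0 => // g M Cg gM.
  rewrite -[RHS](vf (fun x => Complex 0 (g x))); last first.
    by apply/C1cP; split; [exists M => x /gM ->|exact: C1r_cst|exact: Cg].
  by congr (Rint mu); apply/funext => x /=; ring.
by apply: filterS2 h1 h2 => x e1 e2; apply: complex_eq.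
Qed.

End V_identities.

(** * The resolvent of the rank one perturbation *)

Section resolvent_of_perturbation.
Context {R : realType} (mu : bmeasure R) (alpha : R).
Hypothesis hmu : (\int[mu]_(t in [set: mR R]) ((1 + `|(t : R)|)^-1)%:E < +oo)%E.
Hypothesis mu_gt0 : (0 < mu [set: mR R])%E.
Hypothesis alpha0 : alpha != 0.
Implicit Types (z : R[i]) (f g : R -> R[i]).

Lemma cintJ f : cintg mu f -> cint mu (fun x => conjc (f x)) = conjc (cint mu f).
Proof.
move=> [i1 i2]; apply: complex_eq; rewrite !ReImE /=.
  by congr (Rint mu); apply/funext => x; rewrite cReJ.
rewrite -mulN1r -(RintZ _ i2).
by congr (Rint mu); apply/funext => x; rewrite cImJ mulN1r.
Qed.

Lemma cauchyFJ z : Im z != 0 -> cauchyF mu (conjc z) = conjc (cauchyF mu z).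
Proof.
move=> z0; rewrite -cintJ; last exact: rz_cintg.
by congr cint; apply/funext => x; exact: rzJ.
Qed.

Lemma Im_conjc_neq0 z : Im z != 0 -> Im (conjc z) != 0.
Proof. by rewrite cImJ oppr_eq0. Qed.

Lemma n2_rz_gt0 z : Im z != 0 -> 0 < n2 mu (rz z).
Proof.
move=> z0; rewrite lt_neqAle n2_ge0 andbT eq_sym; apply/eqP => h.
have := n2_eq0 (rz_L2 hmu z0) h; rewrite /aeq => -[A [mA A0 sA]].
move: mu_gt0; rewrite (_ : [set: mR R] = A) ?A0 ?ltxx//.
apply/seteqP; split => // x _; apply: sA => /= /eqP.
by rewrite invr_eq0 (negbTE (subz_neq0 x z0)).
Qed.

(** The Herglotz property of F, from Im r_z = Im z |r_z|^2. It keeps 1 + alpha F(z) away from 0 off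
    the real axis. *)
Lemma Im_cauchyF z : Im z != 0 -> Im (cauchyF mu z) = Im z * n2 mu (rz z).
Proof.
move=> z0; rewrite /n2 -RintZ; last by apply: L2_cabs2; exact: rz_L2.
by congr (Rint mu); apply/funext => x; rewrite -/(rz z x) Im_rz cabs2_rz.
Qed.

Lemma denom_neq0 z : Im z != 0 -> 1 + alpha%:C * cauchyF mu z != 0.
Proof.
move=> z0; apply/eqP => /(congr1 (@complex.Im R)); rewrite !ReImE Im_cauchyF//= mul0r addr0 add0r => /eqP.
by rewrite !mulf_eq0 (negbTE alpha0) (negbTE z0) /= gt_eqF// n2_rz_gt0.
Qed.

(** Phrased with [rz] so that [resAE] holds by conversion. *)
Definition resA_coef z f : R[i] :=
  (alpha%:C * cint mu (fun u => f u * rz z u)) / (1 + alpha%:C * cauchyF mu z).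

Lemma resAE z f : resA mu alpha z f = (fun t => rz z t * f t - resA_coef z f * rz z t).
Proof. by []. Qed.

Lemma rzM_L2 (m : bmeasure R) z f : Im z != 0 -> L2 m f -> L2 m (fun t => rz z t * f t).
Proof.
move=> z0; apply: L2M; first exact: rz_measurable.
by move=> x; exact: cabs2_rz_le.
Qed.

Lemma resA_L2 z f : Im z != 0 -> L2 mu f -> L2 mu (resA mu alpha z f).
Proof. by move=> z0 Lf; apply: L2B; [exact: rzM_L2|apply: L2Z; exact: rz_L2]. Qed.

Lemma ipBr (m : bmeasure R) f g k : L2 m f -> L2 m g -> L2 m k ->
  ip m k (fun x => f x - g x) = ip m k f - ip m k g.
Proof. by move=> Lf Lg Lk; rewrite ipC ipBl// ipC [X in _ - X]ipC. Qed.

Lemma conjcM (a b : R[i]) : conjc (a * b) = conjc a * conjc b.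
Proof. by apply: complex_eq; rewrite !ReImE; ring. Qed.

Lemma L2J (m : bmeasure R) f : L2 m f -> L2 m (fun x => conjc (f x)).
Proof.
move=> Lf; apply: (L2_le _ Lf); first exact: cmeasurableJ Lf.1.
by move=> x; rewrite /cabs2 !ReImE sqrrN.
Qed.

(** As alpha is real and F(conj z) = conj F(z), both rank one terms equal the real part of alpha /
    (1 + alpha F(z)) times the integrals of f r_z and of r_z conj(g). *)
Lemma resA_adjoint z f g : Im z != 0 -> L2 mu f -> L2 mu g ->
  ip mu (resA mu alpha z f) g = ip mu f (resA mu alpha (conjc z) g).
Proof.
move=> z0 Lf Lg; have z0' := Im_conjc_neq0 z0; have Lr := rz_L2 hmu z0.
have Lr' := rz_L2 hmu z0'; have L1 := rzM_L2 z0 Lf; have L2g := rzM_L2 z0' Lg.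
have L3 := L2Z (resA_coef z f) Lr; have L4 := L2Z (resA_coef (conjc z) g) Lr'.
rewrite !resAE (ipBl L1 L3 Lg) (ipBr L2g L4 Lf).
congr (_ - _).
  by rewrite ipMl; congr ip; apply/funext => x; rewrite rzJ.
rewrite !ip_cint.
rewrite (_ : (fun x => _) = (fun x => resA_coef z f * (rz z x * conjc (g x)))); last first.
  by apply/funext => x; rewrite mulrA.
rewrite cintZ; last by apply: cintg_mul => //; exact: L2J.
rewrite (_ : (fun x => f x * _) = (fun x => conjc (resA_coef (conjc z) g) * (f x * rz z x))); last first.
  by apply/funext => x; rewrite conjcM rzJ conjcK mulrCA.
rewrite cintZ; last exact: cintg_mul.
congr complex.Re; rewrite /resA_coef cauchyFJ// conjcM conjc_inv conjcM conjc_real.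
rewrite (_ : conjc (1 + alpha%:C * conjc (cauchyF mu z)) = 1 + alpha%:C * cauchyF mu z); last first.
  by apply: complex_eq; rewrite !ReImE /=; ring.
rewrite -cintJ; last by apply: cintg_mul => //; exact: rz_L2.
rewrite (_ : (fun x => conjc _) = (fun x => rz z x * conjc (g x))).
  by ring.
by apply/funext => x; rewrite conjcM rzJ conjcK mulrC.
Qed.

End resolvent_of_perturbation.

(** * Intertwining *)

Section intertwining.
Context {R : realType} (mu nu : bmeasure R) (alpha : R).
Context (W Ws : (R -> R[i]) -> R -> R[i]) (C : R).
Hypothesis hmu : (\int[mu]_(t in [set: mR R]) ((1 + `|(t : R)|)^-1)%:E < +oo)%E.
Hypothesis mu_gt0 : (0 < mu [set: mR R])%E.
Hypothesis alpha0 : alpha != 0.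
Hypothesis W_C1c : forall f, C1c f -> aeq nu (W f) (Vop mu alpha f).
Hypothesis W_lin : forall a f g, L2 mu f -> L2 mu g ->
  aeq nu (W (fun x => a * f x + g x)) (fun x => a * W f x + W g x).
Hypothesis W_bnd : forall f, L2 mu f ->
  L2 nu (W f) /\ (L2norm2 nu (W f) <= C%:E * L2norm2 mu f)%E.
Hypothesis Ws_adj : forall k, L2 nu k -> L2 mu (Ws k) /\
    forall f, L2 mu f -> ip nu (W f) k = ip mu f (Ws k).
Implicit Types (z : R[i]) (f g k : R -> R[i]).

Lemma W_L2 f : L2 mu f -> L2 nu (W f). Proof. by move=> /W_bnd[]. Qed.

Lemma Ws_L2 k : L2 nu k -> L2 mu (Ws k). Proof. by move=> /Ws_adj[]. Qed.

Lemma WsE f k : L2 mu f -> L2 nu k -> ip nu (W f) k = ip mu f (Ws k).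
Proof. by move=> Lf /Ws_adj[_]; apply. Qed.

Lemma W_n2 f : L2 mu f -> n2 nu (W f) <= C * n2 mu f.
Proof. by move=> Lf; have [LW] := W_bnd Lf; rewrite !L2norm2E// lee_fin. Qed.

Lemma W_sub a f g : L2 mu f -> L2 mu g ->
  aeq nu (W (fun x => f x - a * g x)) (fun x => W f x - a * W g x).
Proof.
move=> Lf Lg; have := W_lin (- a) Lg Lf.
rewrite (_ : (fun x => - a * g x + f x) = (fun x => f x - a * g x)); last first.
  by apply/funext => x; rewrite mulNr addrC.
by apply: filterS => x ->; rewrite mulNr addrC.
Qed.

(** The truncations [r n] converge to r_z in L^2(mu), hence their images converge to W r_z in
    L^2(nu), while V (r n) converges pointwise to c r_z by [Vop_rz] and [cvg_Vop_cutoff]. Fatou's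
    lemma identifies the two limits. *)
Lemma W_rz z : Im z != 0 ->
  aeq nu (W (rz z)) (fun s => (1 + alpha%:C * cauchyF mu z) * rz z s).
Proof.
move=> z0; have Lr := rz_L2 hmu z0; have mr := rz_measurable z0.
set c := 1 + _.
pose r n t := rz z t * (cutoff n t)%:C.
have Cr n : C1c (r n) := C1c_rz z0 (C1c_cutoff n).
have Lrn n : L2 mu (r n) := C1c_L2 hmu (Cr n).
have ri := rz_cintg hmu z0.
have cint_lim : ccvg (fun n => cint mu (r n)) (cauchyF mu z).
  have lim (q : mR R -> R) : intg mu q ->
      Rint mu (fun t : mR R => q t * cutoff n t) @[n --> \oo] --> Rint mu q.
    move=> qi; have mq := intg_meas qi; apply: (Rint_dct (g := fun x => `|q x|)) => //.
    - by move=> n; apply: measurable_funM => //; exact: C1r_measurable (C1r_cutoff n).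
    - exact: (integrable_norm qi).
    - apply: nearW => x; rewrite -{2}(mulr1 (q x)).
      by apply: cvgM; [exact: cvg_cst|exact: cvg_cutoff].
    - move=> n x; have /andP[c0 c1] := cutoff_itv n x.
      by rewrite normrM [X in _ * X]ger0_norm// ler_piMr.
  split.
    have := lim _ ri.1; rewrite (_ : (fun n => _) = (fun n => complex.Re (cint mu (r n)))) //.
    by apply/funext => n; congr (Rint mu); apply/funext => t; rewrite /r !ReImE /=; ring.
  have := lim _ ri.2; rewrite (_ : (fun n => _) = (fun n => complex.Im (cint mu (r n)))) //.
  by apply/funext => n; congr (Rint mu); apply/funext => t; rewrite /r !ReImE /=; ring.
have Vlim s : ccvg (fun n => Vop mu alpha (r n) s) (c * rz z s).
  rewrite mulrC (_ : (fun n => _) = (fun n => rz z s *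
    (Vop mu alpha (fun t => (cutoff n t)%:C) s + alpha%:C * cint mu (r n)))); last first.
    by apply/funext => n; apply: (Vop_rz alpha hmu s z0); exact: C1c_cutoff.
  apply: ccvgM; first exact: ccvg_cst.
  by apply: ccvgD; [exact: (cvg_Vop_cutoff alpha hmu)|apply: ccvgM => //; exact: ccvg_cst].
have n2lim : n2 mu (fun x => rz z x - r n x) @[n --> \oo] --> (0 : R).
  suff : n2 mu (fun x => rz z x - r n x) @[n --> \oo] --> Rint mu (fun=> 0) by rewrite Rint0.
  have e n x : cabs2 (rz z x - r n x) = (1 - cutoff n x) ^+ 2 * cabs2 (rz z x).
    by rewrite /r /cabs2 !ReImE /=; ring.
  apply: (Rint_dct (g := fun x : mR R => cabs2 (rz z x))).
  - by move=> n; apply: cmeasurable_cabs2; exact: (L2B Lr (Lrn n)).1.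
  - exact: measurable_cst.
  - exact: L2_cabs2.
  - apply: nearW => x; have h : 1 - cutoff n x @[n --> \oo] --> (1 - 1 : R).
      by apply: cvgB; [exact: cvg_cst|exact: cvg_cutoff].
    have h2 : (1 - cutoff n x) * (1 - cutoff n x) * cabs2 (rz z x) @[n --> \oo] --> (0 : R).
      suff : (1 - cutoff n x) * (1 - cutoff n x) * cabs2 (rz z x) @[n --> \oo] -->
          (1 - 1) * (1 - 1) * cabs2 (rz z x) by rewrite subrr !mul0r.
      by apply: cvgM; [exact: cvgM|exact: cvg_cst].
    rewrite (_ : (fun n => cabs2 _) = (fun n => (1 - cutoff n x) * (1 - cutoff n x) * cabs2 (rz z x))) //.
    by apply/funext => n; rewrite e expr2.
  - move=> n x; rewrite ger0_norm ?cabs2_ge0// e ler_piMl ?cabs2_ge0//.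
    by have /andP[c0 c1] := cutoff_itv n x; nra.
pose d s := W (rz z) s - c * rz z s.
have md : cmeasurable d.
  apply: cmeasurableD; first exact: (W_L2 Lr).1.
  have := cmeasurableM (cmeasurable_cst (- c)) mr.
  by under eq_fun do rewrite mulNr.
pose fn n (s : mR R) := cabs2 (W (rz z) s - W (r n) s).
have LWd n : L2 nu (fun s => W (rz z) s - W (r n) s) by apply: L2B; exact: W_L2.
have fnle n : Rint nu (fn n) <= C * n2 mu (fun x => rz z x - r n x).
  have -> : Rint nu (fn n) = n2 nu (W (fun x => rz z x - r n x)).
    apply: n2_ae; first exact: (LWd n).1.
      by apply: (W_L2 _).1; exact: L2B.
    have := W_sub 1 Lr (Lrn n); under [fun x => rz z x - _]eq_fun do rewrite mul1r.
    by apply: filterS => x ->; rewrite mul1r.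
  by apply: W_n2; exact: L2B.
(* At this stage r_z is not known to lie in L^2(nu), so the integrability of |d|^2 has to come out
   of Fatou as well. *)
have small e : 0 < e -> intg nu (fun s : mR R => cabs2 (d s)) /\ Rint nu (fun s : mR R => cabs2 (d s)) <= e.
  move=> e0.
  have /cvgrPdist_le/(_ e e0)[N _ NP] : C * n2 mu (fun x => rz z x - r n x) @[n --> \oo] --> (0 : R).
    by rewrite -(mulr0 C); apply: cvgM => //; exact: cvg_cst.
  apply: (@fatou_bound _ _ _ nu (fun n => fn (n + N)%N)).
  - by move=> n; exact: L2_cabs2.
  - by move=> n x; exact: cabs2_ge0.
  - by move=> x; exact: cabs2_ge0.
  - exact: cmeasurable_cabs2.
  - have := ae_foralln (fun n => W_C1c (Cr n)).
    apply: filterS => x Wx; rewrite (cvg_shiftn N (fun n => fn n x)).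
    apply: ccvg_cabs2; apply: ccvgB; first exact: ccvg_cst.
    by under eq_fun do rewrite Wx; exact: Vlim.
  - move=> n; apply: (le_trans (fnle _)).
    have := NP (n + N)%N (leq_addl _ _); rewrite /= sub0r normrN.
    exact: le_trans (ler_norm _).
have d0 : Rint nu (fun s : mR R => cabs2 (d s)) = 0.
  apply/eqP; rewrite eq_le; apply/andP; split; last by apply: Rint_ge0 => s; exact: cabs2_ge0.
  by apply/ler_addgt0Pr => e e0; rewrite add0r; exact: (small e e0).2.
have := Rint_ge0_eq0 (small 1 ltr01).1 (fun x => cabs2_ge0 _) d0.
by apply: filterS => x /cabs2_eq0/eqP; rewrite subr_eq0 => /eqP.
Qed.

Lemma rz_L2_nu z : Im z != 0 -> L2 nu (rz z).
Proof.
move=> z0; have c0 := denom_neq0 hmu mu_gt0 alpha0 z0.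
have := L2Z (1 + alpha%:C * cauchyF mu z)^-1 (W_L2 (rz_L2 hmu z0)).
move=> /L2_ae; apply; first exact: rz_measurable.
by apply: filterS (W_rz z0) => x ->; rewrite mulKf.
Qed.

(** The constant alpha int r_z f dmu that [Vop_rz] produces is cancelled by [resA_coef] times the
    factor 1 + alpha F(z) from [W_rz]. *)
Lemma W_resA_C1c z f : Im z != 0 -> C1c f ->
  aeq nu (W (resA mu alpha z f)) (fun s => rz z s * W f s).
Proof.
move=> z0 Cf; have c0 := denom_neq0 hmu mu_gt0 alpha0 z0.
have Lf := C1c_L2 hmu Cf; have Lr := rz_L2 hmu z0.
have Crf := C1c_rz z0 Cf.
have h1 := W_sub (resA_coef mu alpha z f) (C1c_L2 hmu Crf) Lr.
have h2 := W_C1c Crf; have h3 := W_rz z0; have h4 := W_C1c Cf.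
apply: aeq_trans h1 _.
move: h2 h3 h4; apply: filterS3 => x h2 h3 h4; rewrite h2 h3 h4.
have -> : resA_coef mu alpha z f * ((1 + alpha%:C * cauchyF mu z) * rz z x) =
    rz z x * (alpha%:C * cint mu (fun u => rz z u * f u)).
  rewrite /resA_coef (_ : (fun u => f u * rz z u) = (fun u => rz z u * f u)).
    by field.
  by apply/funext => u; rewrite mulrC.
by rewrite Vop_rz//; ring.
Qed.

(** The dual of [W_resA_C1c] at conj z. An element of L^2(mu) is determined by its inner products
    with C^1 functions, so the identity already holds for every k in L^2(nu). *)
Lemma Ws_rz z k : Im z != 0 -> L2 nu k ->
  aeq mu (Ws (fun s => rz z s * k s)) (resA mu alpha z (Ws k)).
Proof.
move=> z0 Lk; have z0' := Im_conjc_neq0 z0.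
have Lrk := rzM_L2 z0 Lk; have LA := resA_L2 alpha hmu z0 (Ws_L2 Lk).
have Ld := L2B (Ws_L2 Lrk) LA.
have : aeq mu (fun x => Ws (fun s => rz z s * k s) x - resA mu alpha z (Ws k) x) (fun=> 0).
  apply: (C1c_perp_ae0 hmu Ld) => f Cf; have Lf := C1c_L2 hmu Cf.
  rewrite ipBr//; last exact: Ws_L2.
  rewrite -WsE// -[z in X in _ - X]conjcK -resA_adjoint//; last exact: Ws_L2.
  rewrite -(WsE (resA_L2 alpha hmu z0' Lf) Lk).
  rewrite (@ip_ae _ nu (W (resA mu alpha (conjc z) f)) (fun s => rz (conjc z) s * W f s)).
  - rewrite ipMl (_ : (fun x => _) = (fun s => rz z s * k s)) ?subrr//.
    by apply/funext => s; rewrite rzJ conjcK.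
  - by apply: (W_L2 _).1; exact: resA_L2.
  - by apply: (rzM_L2 z0' (W_L2 Lf)).1.
  - exact: Lk.1.
  - exact: W_resA_C1c.
by apply: filterS => x /eqP; rewrite subr_eq0 => /eqP.
Qed.

(** Dualising [Ws_rz] back removes the restriction to C^1 functions. *)
Lemma W_resA z f : Im z != 0 -> L2 mu f ->
  aeq nu (W (resA mu alpha z f)) (fun s => rz z s * W f s).
Proof.
move=> z0 Lf; have z0' := Im_conjc_neq0 z0.
have LA := resA_L2 alpha hmu z0 Lf.
apply: ip_ext; [exact: W_L2|by apply: rzM_L2 => //; exact: W_L2|move=> k Lk].
rewrite WsE// resA_adjoint//; last exact: Ws_L2.
have Lrk := rzM_L2 z0' Lk.
rewrite ipC -(ip_ae _ _ _ (Ws_rz z0' Lk)); last 3 first.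
- by apply: (Ws_L2 _).1.
- by apply: (resA_L2 _ _ _ _).1 => //; exact: Ws_L2.
- exact: Lf.1.
rewrite ipC -WsE// ipMl; congr ip; apply/funext => s; by rewrite rzJ.
Qed.

End intertwining.

(** * Operators commuting with the resolvent of multiplication by s *)

Section newton_sign.
Context {R : realType}.
Implicit Types u : R.

(** Expanded into sums and products with constants so that [commutesD] and [commutesM] apply to it
    literally. *)
Definition newton_step u := 3 / 2 * u + - 2^-1 * (u * (u * u)).
Definition newton_iter n u := iter n newton_step u.

Lemma newton_stepN u : newton_step (- u) = - newton_step u.
Proof. by rewrite /newton_step; ring. Qed.

Lemma newton_iterN n u : newton_iter n (- u) = - newton_iter n u.
Proof. by elim: n => //= n ->; rewrite newton_stepN. Qed.

Lemma newton_iter0 n : newton_iter n (0 : R) = 0.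
Proof. by elim: n => //= n ->; rewrite /newton_step; ring. Qed.

(** One step multiplies the error 1 - v by (1 - v) (2 + v) / 2 = 1 - v/2 - v^2/2, which is at most 1
    - u/2 as long as v >= u; the iterates increase, so this persists. *)
Lemma newton_iter_pos n u : 0 < u -> u <= 1 ->
  u <= newton_iter n u <= 1 /\ 1 - newton_iter n u <= (1 - u / 2) ^+ n.
Proof.
move=> u0 u1; elim: n => [|n [/andP[IH1 IH2] IH3]]; first by rewrite expr0 /= lexx; split; lra.
rewrite /= exprS; move: IH1 IH2 IH3; set v := newton_iter n u; set q := _ ^+ n => h1 h2 h3.
rewrite /newton_step.
have e : 1 - (3 / 2 * v + - 2^-1 * (v * (v * v))) = (1 - v) * ((1 - v) * (2 + v) / 2) by field.
have v0 : 0 < v by lra.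
have g1 : 3 / 2 * v + - 2^-1 * (v * (v * v)) - v = 2^-1 * v * ((1 - v) * (1 + v)) by field.
have g2 : 0 <= 2^-1 * v * ((1 - v) * (1 + v)) by rewrite !mulr_ge0//; lra.
have g3 : 0 <= (1 - v) * ((1 - v) * (2 + v) / 2) by rewrite !mulr_ge0//; lra.
have g4 : (1 - v) * (2 + v) / 2 <= 1 - u / 2 by nra.
have g5 : (1 - v) * ((1 - v) * (2 + v) / 2) <= q * (1 - u / 2).
  by apply: ler_pM => //; [lra|rewrite !mulr_ge0//; lra].
by rewrite e; split; [apply/andP; split; lra|lra].
Qed.

Lemma newton_iter_le1 n u : `|u| <= 1 -> `|newton_iter n u| <= 1.
Proof.
have pos v : 0 < v -> v <= 1 -> `|newton_iter n v| <= 1.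
  move=> v0 v1; have [/andP[h1 h2] _] := newton_iter_pos n v0 v1.
  by rewrite ger0_norm//; lra.
rewrite ler_norml => /andP[h1 h2]; have [u0|u0|->] := ltgtP u 0.
- by rewrite -normrN -newton_iterN pos//; lra.
- exact: pos.
- by rewrite newton_iter0 normr0.
Qed.

Lemma cvg_newton_sign u : `|u| <= 1 -> newton_iter n u @[n --> \oo] --> Num.sg u.
Proof.
have pos v : 0 < v -> v <= 1 -> newton_iter n v @[n --> \oo] --> (1 : R).
  move=> v0 v1; apply/cvgrPdist_le => e e0.
  have : (1 - v / 2) ^+ n @[n --> \oo] --> (0 : R) by apply: cvg_expr; rewrite ger0_norm; lra.
  move=> /cvgrPdist_le/(_ e e0); apply: filterS => n; rewrite sub0r normrN.
  have [/andP[h1 h2] h3] := newton_iter_pos n v0 v1.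
  rewrite [X in X <= _ -> _]ger0_norm; last by rewrite exprn_ge0//; lra.
  by rewrite ger0_norm; lra.
rewrite ler_norml => /andP[h1 h2]; have [u0|u0|->] := ltgtP u 0.
- rewrite ltr0_sg//; have h : 0 < - u by lra.
  rewrite (_ : (fun n => _) = (fun n => - newton_iter n (- u))); last first.
    by apply/funext => n; rewrite newton_iterN opprK.
  by apply: cvgN; apply: pos => //; lra.
- by rewrite gtr0_sg//; exact: pos.
- by rewrite sgr0; under eq_fun do rewrite newton_iter0; exact: cvg_cst.
Qed.

End newton_sign.

(** * Symmetric operators commuting with all r_z are multiplications *)

Section multiplication_operator.
Context {R : realType} (nu : bmeasure R) (Phi : (R -> R[i]) -> R -> R[i]) (w : R -> R).
Implicit Types (g k : R -> R[i]) (u v : R -> R).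
Hypothesis Phi_L2 : forall g, L2 nu g -> L2 nu (Phi g).
Hypothesis Phi_lin : forall a g k, L2 nu g -> L2 nu k ->
  aeq nu (Phi (fun x => a * g x + k x)) (fun x => a * Phi g x + Phi k x).
Hypothesis Phi_sym : forall g k, L2 nu g -> L2 nu k -> ip nu (Phi g) k = ip nu g (Phi k).
Hypothesis Phi_rz : forall z g, Im z != 0 -> L2 nu g ->
  aeq nu (Phi (fun s => rz z s * g s)) (fun s => rz z s * Phi g s).

Definition bounded_mfun u := measurable_fun [set: mR R] (u : mR R -> R) /\
  exists K, forall x, `|u x| <= K.

Definition commutes u := bounded_mfun u /\ forall g, L2 nu g ->
  aeq nu (Phi (fun s => (u s)%:C * g s)) (fun s => (u s)%:C * Phi g s).

Lemma bounded_mfun_L2 u g : bounded_mfun u -> L2 nu g -> L2 nu (fun s => (u s)%:C * g s).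
Proof.
move=> [mu [K uK]]; apply: (L2M (K := K ^+ 2)); first exact: cmeasurable_real.
move=> x; rewrite /cabs2 /= expr0n addr0 -(real_normK (num_real (u x))).
by rewrite lerXn2r ?nnegrE// (le_trans _ (uK x)).
Qed.

Lemma commutes_cst c : commutes (fun=> c).
Proof.
split; first by split; [exact: measurable_cst|exists `|c|].
have Phi0 : aeq nu (Phi (fun=> 0)) (fun=> 0).
  have := Phi_lin 1 (L2_0 nu) (L2_0 nu); rewrite mulr0 addr0.
  apply: filterS => x /eqP; rewrite mul1r -subr_eq0 opprD addNKr oppr_eq0 => /eqP //.
move=> g Lg; have := Phi_lin c%:C Lg (L2_0 nu); under [fun x => _ + 0]eq_fun do rewrite addr0.
by move: Phi0; apply: filterS2 => x -> ->; rewrite addr0.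
Qed.

Lemma commutesD u v : commutes u -> commutes v -> commutes (fun s => u s + v s).
Proof.
move=> [bu cu] [bv cv]; split.
  case: bu bv => [mu [K uK]] [mv [L vL]]; split; first exact: measurable_funD.
  by exists (K + L) => x; rewrite (le_trans (ler_normD _ _))// lerD.
move=> g Lg; have Lu := bounded_mfun_L2 bu Lg; have Lv := bounded_mfun_L2 bv Lg.
rewrite (_ : (fun s => (u s + v s)%:C * g s) = (fun s => 1 * ((u s)%:C * g s) + (v s)%:C * g s)); last first.
  by apply/funext => s; apply: complex_eq; rewrite !ReImE /=; ring.
apply: aeq_trans (Phi_lin 1 Lu Lv) _.
move: (cu g Lg) (cv g Lg); apply: filterS2 => s -> ->.
by apply: complex_eq; rewrite !ReImE /=; ring.
Qed.

Lemma commutesM u v : commutes u -> commutes v -> commutes (fun s => u s * v s).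
Proof.
move=> [bu cu] [bv cv]; split.
  case: bu bv => [mu [K uK]] [mv [L vL]]; split; first exact: measurable_funM.
  by exists (K * L) => x; rewrite normrM ler_pM.
move=> g Lg; have Lv := bounded_mfun_L2 bv Lg.
rewrite (_ : (fun s => (u s * v s)%:C * g s) = (fun s => (u s)%:C * ((v s)%:C * g s))); last first.
  by apply/funext => s; apply: complex_eq; rewrite !ReImE /=; ring.
apply: aeq_trans (cu _ Lv) _; move: (cv g Lg); apply: filterS => s ->.
by apply: complex_eq; rewrite !ReImE /=; ring.
Qed.

Lemma ip_dct (u_ : nat -> R -> R) u K g k : (forall n, bounded_mfun (u_ n)) -> bounded_mfun u ->
  (forall n x, `|u_ n x| <= K) -> (forall x, u_ n x @[n --> \oo] --> u x) ->
  L2 nu g -> L2 nu k ->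
  ip nu (fun s => (u_ n s)%:C * g s) k @[n --> \oo] --> ip nu (fun s => (u s)%:C * g s) k.
Proof.
move=> bu_ bu uK ulim Lg Lk.
pose q (x : mR R) := complex.Re (g x) * complex.Re (k x) + complex.Im (g x) * complex.Im (k x).
have qi : intg nu q := ip_intg Lg Lk.
have ipE (v : R -> R) : ip nu (fun s => (v s)%:C * g s) k = Rint nu (fun x => v x * q x).
  by congr (Rint nu); apply/funext => x; rewrite !ReImE /= /q; ring.
rewrite ipE; under eq_fun do rewrite ipE.
apply: (Rint_dct (g := fun x => K * `|q x|)).
- by move=> n; apply: measurable_funM; [exact: (bu_ n).1|exact: intg_meas qi].
- by apply: measurable_funM; [exact: bu.1|exact: intg_meas qi].
- by apply: intgZ; exact: (integrable_norm qi).
- by apply: nearW => x; apply: cvgM; [exact: ulim|exact: cvg_cst].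
- by move=> n x; rewrite normrM ler_wpM2r.
Qed.

(** Symmetry moves [Phi] onto the test function, which turns both sides into limits of inner
    products between fixed vectors, governed by dominated convergence. *)
Lemma commutes_lim (u_ : nat -> R -> R) u K : (forall n, commutes (u_ n)) ->
  (forall n x, `|u_ n x| <= K) -> (forall x, u_ n x @[n --> \oo] --> u x) -> commutes u.
Proof.
move=> cu uK ulim.
have bu : bounded_mfun u.
  split; first by apply: (measurable_fun_cvg (fun n => (cu n).1.1)) => x _; exact: ulim.
  exists K => x; apply: (cvgr_to_le (cvg_norm (ulim x))); exact: nearW.
split=> // g Lg; have Lug := bounded_mfun_L2 bu Lg; have LPg := Phi_L2 Lg.
apply: ip_ext; [exact: Phi_L2|exact: bounded_mfun_L2|move=> k Lk].
have h1 := ip_dct (fun n => (cu n).1) bu uK ulim Lg (Phi_L2 Lk).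
have h2 := ip_dct (fun n => (cu n).1) bu uK ulim LPg Lk.
have E : (fun n => ip nu (fun s => (u_ n s)%:C * g s) (Phi k)) =
    (fun n => ip nu (fun s => (u_ n s)%:C * Phi g s) k).
  apply/funext => n; have Ln := bounded_mfun_L2 (cu n).1 Lg.
  rewrite -Phi_sym//; apply: ip_ae.
  - exact: (Phi_L2 Ln).1.
  - exact: (bounded_mfun_L2 (cu n).1 LPg).1.
  - exact: Lk.1.
  - exact: (cu n).2.
by rewrite E in h1; rewrite Phi_sym//; exact: (cvg_unique _ h1 h2).
Qed.

Lemma commutes_ray a : commutes (\1_(`]a, +oo[%classic)).
Proof.
pose z : R[i] := Complex a 1.
have z0 : Im z != 0 by rewrite /= oner_eq0.
have z0' := Im_conjc_neq0 z0.
(* This is r_z + r_{conj z}, so [Phi] commutes with it. It equals 2 (s - a) / ((s - a)^2 + 1), which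
   lies in [-1, 1] and has the sign of s - a. *)
pose x s := 2 * complex.Re (rz z s).
have xE s : x s = 2 * (s - a) / ((s - a) ^+ 2 + 1) by rewrite /x Re_rz /rzden /= expr1n mulrA.
have x1 s : `|x s| <= 1.
  rewrite xE; have d0 : 0 < (s - a) ^+ 2 + 1 by have := sqr_ge0 (s - a); lra.
  rewrite normrM normfV (gtr0_norm d0) ler_pdivrMr// mul1r ler_norml.
  by have := sqr_ge0 (s - a - 1); have := sqr_ge0 (s - a + 1) => *; apply/andP; split; nra.
have cx : commutes x.
  split.
    split; last by exists 1.
    by apply: measurable_funM => //; have [] := rz_measurable z0.
  move=> g Lg; have L1 := rzM_L2 z0 Lg; have L2' := rzM_L2 z0' Lg.
  have e (g' : R -> R[i]) : (fun s => (x s)%:C * g' s) = (fun s => 1 * (rz z s * g' s) + rz (conjc z) s * g' s).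
    by apply/funext => s; rewrite rzJ /x; move: (rz z s) (g' s) => [r1 r2] [g1 g2];
      apply: complex_eq => /=; ring.
  rewrite !e; apply: aeq_trans (Phi_lin 1 L1 L2') _.
  by move: (Phi_rz z0 Lg) (Phi_rz z0' Lg); apply: filterS2 => s -> ->.
have cn n : commutes (fun s => newton_iter n (x s)).
  elim: n => [//|n IH].
  apply: (commutesD (commutesM (commutes_cst _) IH)).
  by apply: (commutesM (commutes_cst _)); apply: commutesM => //; exact: commutesM.
have csg : commutes (fun s => Num.sg (x s)).
  apply: (commutes_lim cn (K := 1)) => [n s|s]; first exact: newton_iter_le1.
  exact: cvg_newton_sign.
(* The square of the sign rather than 1 gives the value 0 at s = a, as the open ray demands. *)
have -> : \1_(`]a, +oo[%classic) = (fun s => 2^-1 * (Num.sg (x s) * Num.sg (x s) + Num.sg (x s))).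
  apply/funext => s; have d0 : 0 < (s - a) ^+ 2 + 1 by have := sqr_ge0 (s - a); lra.
  rewrite xE !sgrM sgrV (gtr0_sg d0) (gtr0_sg (ltr0n R 2)) mul1r mulr1.
  rewrite indicE; have [as'|sa|as'] := ltgtP a s.
  - rewrite mem_set; last by rewrite /= in_itv/= as'.
    by rewrite gtr0_sg ?subr_gt0//=; field.
  - rewrite memNset; last by rewrite /= in_itv/= ltNge (ltW sa).
    by rewrite ltr0_sg ?subr_lt0//=; field.
  - rewrite memNset; last by rewrite /= in_itv/= as' ltxx.
    by rewrite as' subrr sgr0 /=; field.
apply: (commutesM (commutes_cst _)); apply: commutesD => //; exact: commutesM.
Qed.

Hypothesis w_gt0 : forall s, 0 < w s.
Hypothesis w_L2 : L2 nu (fun s => (w s)%:C).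
Hypothesis wV_meas : measurable_fun [set: mR R] (fun s : mR R => (w s)^-1).

(* For commuting u, (u Phi g, w) = (Phi (u g), w) = (u g, Phi w); rays u determine the densities. *)
Lemma Phi_multiplication : exists2 phi : mR R -> R, measurable_fun [set: mR R] phi &
  forall g, L2 nu g -> aeq nu (Phi g) (fun s => (phi s)%:C * g s).
Proof.
pose a s := complex.Re (Phi (fun s => (w s)%:C) s).
pose b s := complex.Im (Phi (fun s => (w s)%:C) s).
have LPw := Phi_L2 w_L2.
have key g : L2 nu g ->
    {ae nu, forall s : mR R, complex.Re (Phi g s) * w s = complex.Re (g s) * a s + complex.Im (g s) * b s}.
  move=> Lg; have LPg := Phi_L2 Lg.
  pose p1 (s : mR R) := complex.Re (Phi g s) * complex.Re (w s)%:C + complex.Im (Phi g s) * complex.Im (w s)%:C.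
  pose p2 (s : mR R) := complex.Re (g s) * a s + complex.Im (g s) * b s.
  have i1 : intg nu p1 := ip_intg LPg w_L2.
  have i2 : intg nu p2 := ip_intg Lg LPw.
  have test u : commutes u -> Rint nu (fun s : mR R => (p1 s - p2 s) * u s) = 0.
    move=> [bu cu]; have Lug := bounded_mfun_L2 bu Lg; have LuP := bounded_mfun_L2 bu LPg.
    have j1 := ip_intg LuP w_L2; have j2 := ip_intg Lug LPw.
    rewrite (_ : (fun s => _) = (fun s : mR R =>
      (complex.Re ((u s)%:C * Phi g s) * complex.Re (w s)%:C + complex.Im ((u s)%:C * Phi g s) * complex.Im (w s)%:C) -
      (complex.Re ((u s)%:C * g s) * a s + complex.Im ((u s)%:C * g s) * b s))); last first.
      by apply/funext => s; rewrite !ReImE /p1 /p2 /=; ring.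
    rewrite (RintB j1 j2) -[X in _ - X]/(ip nu _ (Phi _)) -Phi_sym//.
    rewrite -[X in X - _]/(ip nu _ (fun s => (w s)%:C)).
    rewrite (ip_ae _ _ _ (cu g Lg)) ?subrr//.
    - by apply: (Phi_L2 _).1.
    - by exact: LuP.1.
    - exact: w_L2.1.
  have : {ae nu, forall s : mR R, p1 s - p2 s = 0}.
    apply: ray_integral_ae0; first exact: intgB.
      by have := test _ (commutes_cst 1); under eq_fun do rewrite mulr1.
    by move=> c; exact: test (commutes_ray c).
  by apply: filterS => s /eqP; rewrite subr_eq0 /p1 /p2 /= mulr0 addr0 => /eqP.
have Phi_i g : L2 nu g -> aeq nu (Phi (fun s => Complex 0 1 * g s)) (fun s => Complex 0 1 * Phi g s).
  move=> Lg; have := Phi_lin (Complex 0 1) Lg (L2_0 nu); under [fun x => _ + 0]eq_fun do rewrite addr0.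
  have [_ c0] := commutes_cst 0; have := c0 _ (L2_0 nu); under [fun s => 0%:C * 0]eq_fun do rewrite mulr0.
  by apply: filterS2 => x -> ->; rewrite mul0r addr0.
(* The real inner product yields one real equation for [Phi g]; applying it to i g yields the
   equation for the imaginary part. *)
have key2 g : L2 nu g ->
    {ae nu, forall s : mR R, - complex.Im (Phi g s) * w s = - complex.Im (g s) * a s + complex.Re (g s) * b s}.
  move=> Lg; move: (key _ (L2Z (Complex 0 1) Lg)) (Phi_i g Lg).
  by apply: filterS2 => s h1 h2; move: h1; rewrite h2 !ReImE /= !mul0r !mul1r !sub0r !add0r.
(* At g = w the second equation reads - b w = w b. *)
have b0 : {ae nu, forall s : mR R, b s = 0}.
  move: (key2 _ w_L2); apply: filterS => s; rewrite -/(b s) /= => h.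
  by have := w_gt0 s; nra.
exists (fun s => a s / w s).
  by apply: measurable_funM => //; have [] := LPw.1.
move=> g Lg; move: (key g Lg) (key2 g Lg) b0; apply: filterS3 => s h1 h2 h3.
have w0 := w_gt0 s; move: h1 h2; rewrite h3 !mulr0 !addr0 => h1 h2.
have w1 : w s != 0 by rewrite gt_eqF.
apply: complex_eq; rewrite !ReImE /= mul0r ?subr0 ?addr0; apply: (mulIf w1).
  by rewrite h1; field.
by rewrite -[LHS]opprK -mulNr h2; field.
Qed.

End multiplication_operator.

(** * Polar decomposition *)

Section symbol.
Context {R : realType} (mu nu : bmeasure R).
Context (W Ws : (R -> R[i]) -> R -> R[i]) (C : R).
Hypothesis W_aeq : forall f g, L2 mu f -> L2 mu g -> aeq mu f g -> aeq nu (W f) (W g).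
Hypothesis W_lin : forall a f g, L2 mu f -> L2 mu g ->
  aeq nu (W (fun x => a * f x + g x)) (fun x => a * W f x + W g x).
Hypothesis W_bnd : forall f, L2 mu f ->
  L2 nu (W f) /\ (L2norm2 nu (W f) <= C%:E * L2norm2 mu f)%E.
Hypothesis Ws_adj : forall k, L2 nu k -> L2 mu (Ws k) /\
    forall f, L2 mu f -> ip nu (W f) k = ip mu f (Ws k).
Implicit Types (z : R[i]) (f g k : R -> R[i]).

Local Notation W_L2 := (W_L2 W_bnd).
Local Notation Ws_L2 := (Ws_L2 Ws_adj).
Local Notation WsE := (WsE Ws_adj).
Local Notation Phi := (fun k => W (Ws k)).

Lemma WsEr f k : L2 mu f -> L2 nu k -> ip mu (Ws k) f = ip nu k (W f).
Proof. by move=> Lf Lk; rewrite ipC -WsE// ipC. Qed.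

Lemma W_scale a f : L2 mu f -> aeq nu (W (fun x => a * f x)) (fun x => a * W f x).
Proof.
move=> Lf; have W0 : aeq nu (W (fun=> 0)) (fun=> 0).
  have := W_lin 1 (L2_0 mu) (L2_0 mu); rewrite mulr0 addr0.
  by apply: filterS => x /eqP; rewrite mul1r -subr_eq0 opprD addNKr oppr_eq0 => /eqP.
have := W_lin a Lf (L2_0 mu); under [fun x => _ + 0]eq_fun do rewrite addr0.
by move: W0; apply: filterS2 => x -> ->; rewrite addr0.
Qed.

Lemma Ws_lin a g k : L2 nu g -> L2 nu k ->
  aeq mu (Ws (fun x => a * g x + k x)) (fun x => a * Ws g x + Ws k x).
Proof.
move=> Lg Lk; have Lag := L2Z a Lg; have LWg := Ws_L2 Lg; have LWk := Ws_L2 Lk.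
apply: ip_ext; [by apply: Ws_L2; exact: L2D|by apply: L2D => //; exact: L2Z|move=> f Lf].
rewrite WsEr//; last exact: L2D.
have LWf := W_L2 Lf; have Laf := L2Z (conjc a) Lf.
rewrite ipDl// ipDl//; last exact: L2Z.
rewrite !ipMl !WsEr//; congr (_ + _); rewrite ipC [RHS]ipC.
apply: ip_ae; [exact: (L2Z _ LWf).1|exact: (W_L2 Laf).1|exact: Lg.1|].
by apply: aeq_sym; exact: W_scale.
Qed.

Lemma WWs_L2 g : L2 nu g -> L2 nu (Phi g).
Proof. by move=> Lg; apply: W_L2; exact: Ws_L2. Qed.

Lemma WWs_lin a g k : L2 nu g -> L2 nu k ->
  aeq nu (Phi (fun x => a * g x + k x)) (fun x => a * Phi g x + Phi k x).
Proof.
move=> Lg Lk; have LWg := Ws_L2 Lg; have LWk := Ws_L2 Lk.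
apply: aeq_trans (W_lin a LWg LWk); apply: W_aeq; last exact: Ws_lin.
  by apply: Ws_L2; apply: L2D => //; exact: L2Z.
by apply: L2D => //; exact: L2Z.
Qed.

Lemma WWs_sym g k : L2 nu g -> L2 nu k -> ip nu (Phi g) k = ip nu g (Phi k).
Proof. by move=> Lg Lk; rewrite WsE ?WsEr//; exact: Ws_L2. Qed.

Variables (w phi : R -> R).
Hypothesis w_gt0 : forall s, 0 < w s.
Hypothesis w_L2 : L2 nu (fun s => (w s)%:C).
Hypothesis w_range : exists2 f, L2 mu f & aeq nu (fun s => (complex.Re (W f s))%:C) (fun s => (w s)%:C).
Hypothesis phi_meas : measurable_fun [set: mR R] (phi : mR R -> R).
Hypothesis phiE : forall g, L2 nu g -> aeq nu (Phi g) (fun s => (phi s)%:C * g s).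

Lemma indic_L2 (B : set (mR R)) g : measurable B -> L2 nu g ->
  L2 nu (fun s => (\1_B s)%:C * g s).
Proof.
move=> mB; apply: (L2M (K := 1)); first by apply: cmeasurable_real; exact: measurable_indic.
by move=> s; rewrite /cabs2 /= indicE; case: (s \in B) => /=; lra.
Qed.

Lemma nonneg_test (B : set (mR R)) (q : mR R -> R) : measurable B -> (forall s, B s -> 0 < q s) ->
  intg nu (fun s => \1_B s * q s) -> Rint nu (fun s => \1_B s * q s) <= 0 ->
  {ae nu, forall s : mR R, ~ B s}.
Proof.
move=> mB qB qi qI.
have q0 s : 0 <= \1_B s * q s.
  rewrite indicE; have [/set_mem Bs|_] := boolP (s \in B); last by rewrite mul0r.
  by rewrite mul1r ltW// qB.
have q1 : Rint nu (fun s => \1_B s * q s) = 0.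
  by apply/eqP; rewrite eq_le qI Rint_ge0.
have := Rint_ge0_eq0 qi q0 q1; apply: filterS => s /eqP h Bs.
by move: h; rewrite indicE mem_set// mul1r gt_eqF// qB.
Qed.

(* For k = w 1_B, n2 (Phi k) <= C n2 (Ws k) reads int_B phi^2 w^2 <= C int_B phi w^2, which
   fails on B = {phi > |C|}; on B = {phi <= 0} it is Ws k = 0 that contradicts w_range. *)
Lemma phi_bounds : {ae nu, forall s : mR R, 0 < phi s /\ phi s <= `|C|}.
Proof.
pose B1 : set (mR R) := [set s | phi s <= 0].
pose B2 : set (mR R) := [set s | `|C| < phi s].
have mB1 : measurable B1 by rewrite -[B1]setTI; exact: measurable_fun_le.
have mB2 : measurable B2.
  rewrite (_ : B2 = ~` (setT `&` [set s : mR R | phi s <= `|C|])).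
    by apply: measurableC; exact: measurable_fun_le.
  by apply/seteqP; split => s; rewrite /B2 setTI /= ltNge => /negP.
have quad (B : set (mR R)) : measurable B -> let k := fun s => (\1_B s)%:C * (w s)%:C in
    [/\ L2 nu k, intg nu (fun s : mR R => \1_B s * (phi s * w s ^+ 2)),
      n2 mu (Ws k) = Rint nu (fun s : mR R => \1_B s * (phi s * w s ^+ 2)),
      intg nu (fun s : mR R => \1_B s * (phi s ^+ 2 * w s ^+ 2)) &
      n2 nu (Phi k) = Rint nu (fun s : mR R => \1_B s * (phi s ^+ 2 * w s ^+ 2))].
  move=> mB k; have Lk : L2 nu k by exact: indic_L2.
  have LP := WWs_L2 Lk; have LWk := Ws_L2 Lk.
  have mpk : cmeasurable (fun s => (phi s)%:C * k s).
    by apply: cmeasurableM; [exact: cmeasurable_real|exact: Lk.1].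
  have Lpk := L2_ae LP mpk (phiE Lk).
  have bb (s : mR R) : (\1_B s : R) * \1_B s = \1_B s.
    by rewrite indicE; case: (s \in B); rewrite ?mulr1 ?mulr0.
  have e1 : (fun s : mR R => complex.Re ((phi s)%:C * k s) * complex.Re (k s) +
      complex.Im ((phi s)%:C * k s) * complex.Im (k s)) = (fun s => \1_B s * (phi s * w s ^+ 2)).
    by apply/funext => s; rewrite -[in RHS]bb /k !ReImE /=; ring.
  have e2 : (fun s : mR R => cabs2 ((phi s)%:C * k s)) = (fun s => \1_B s * (phi s ^+ 2 * w s ^+ 2)).
    by apply/funext => s; rewrite -[in RHS]bb /k /cabs2 !ReImE /=; ring.
  split => //.
  - by rewrite -e1; exact: ip_intg.
  - rewrite -e1 -ipff -WsE// -[RHS]/(ip nu _ k).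
    by apply: ip_ae (phiE Lk); [exact: LP.1|exact: mpk|exact: Lk.1].
  - by rewrite -e2; exact: L2_cabs2.
  - by rewrite -e2; apply: n2_ae (phiE Lk); [exact: LP.1|exact: mpk].
have null1 : {ae nu, forall s : mR R, ~ B1 s}.
  have [Lk i1 e1 _ _] := quad _ mB1; set k := fun s => _ in Lk e1.
  have n0 : n2 mu (Ws k) = 0.
    apply/eqP; rewrite eq_le n2_ge0 andbT e1 -(Rint0 nu); apply: Rint_le => //; first exact: integrable0.
    move=> s; rewrite indicE; have [/set_mem Bs|_] := boolP (s \in B1); last by rewrite mul0r.
    by rewrite mul1r mulr_le0_ge0 ?sqr_ge0.
  have Wk0 := n2_eq0 (Ws_L2 Lk) n0.
  have [f Lf fw] := w_range.
  have : ip nu (W f) k = 0.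
    rewrite WsE// ipC -[RHS](ip0l mu f).
    by apply: ip_ae Wk0; [exact: (Ws_L2 Lk).1|exact: cmeasurable_cst|exact: Lf.1].
  (* As k is real, only the real part of W f enters, and that is w. *)
  have -> : ip nu (W f) k = ip nu (fun s => (complex.Re (W f s))%:C) k.
    by congr (Rint nu); apply/funext => s; rewrite /k !ReImE /=; ring.
  have mRe : cmeasurable (fun s => (complex.Re (W f s))%:C).
    by apply: cmeasurable_real; exact: (W_L2 Lf).1.1.
  rewrite (ip_ae mRe w_L2.1 Lk.1 fw) => h.
  have e (s : mR R) : complex.Re (w s)%:C * complex.Re (k s) + complex.Im (w s)%:C * complex.Im (k s) = \1_B1 s * (w s ^+ 2).
    by rewrite /k !ReImE /=; ring.
  apply: (@nonneg_test _ (fun s => w s ^+ 2)) => //.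
  - by move=> s _; rewrite exprn_gt0.
  - by have := ip_intg w_L2 Lk; under eq_fun do rewrite e.
  - by move: h; rewrite /ip; under eq_fun do rewrite e; move=> ->.
have null2 : {ae nu, forall s : mR R, ~ B2 s}.
  have [Lk i1 e1 i2 e2] := quad _ mB2; set k := fun s => _ in Lk e1 e2.
  have eq (s : mR R) : \1_B2 s * (phi s ^+ 2 * w s ^+ 2) - `|C| * (\1_B2 s * (phi s * w s ^+ 2)) =
      \1_B2 s * (phi s * w s ^+ 2 * (phi s - `|C|)) by ring.
  have i3 := intgZ `|C| i1.
  apply: (@nonneg_test _ (fun s => phi s * w s ^+ 2 * (phi s - `|C|))) => //.
  - move=> s Bs; have c0 := normr_ge0 C; have h : `|C| < phi s := Bs.
    by rewrite !mulr_gt0 ?exprn_gt0 ?subr_gt0//; lra.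
  - by have := intgB i2 i3; under eq_fun do rewrite eq.
  - have -> : (fun s : mR R => \1_B2 s * (phi s * w s ^+ 2 * (phi s - `|C|))) =
        (fun s : mR R => \1_B2 s * (phi s ^+ 2 * w s ^+ 2) - `|C| * (\1_B2 s * (phi s * w s ^+ 2))).
      by apply/funext => s; rewrite eq.
    rewrite (RintB i2 i3) (RintZ _ i1) -e1 -e2 subr_le0.
    apply: (le_trans (W_n2 W_bnd (Ws_L2 Lk))).
    by rewrite ler_wpM2r ?n2_ge0 ?ler_norm.
move: null1 null2; apply: filterS2 => s h1 h2; split.
  by rewrite ltNge; apply/negP => h; apply: h1.
by rewrite leNgt; apply/negP => h; apply: h2.
Qed.

End symbol.

(** * The weight h and the unitary operator *)

Section unitary_part.
Context {R : realType} (mu nu : bmeasure R).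
Context (W Ws : (R -> R[i]) -> R -> R[i]) (C : R) (phi : R -> R).
Hypothesis W_lin : forall a f g, L2 mu f -> L2 mu g ->
  aeq nu (W (fun x => a * f x + g x)) (fun x => a * W f x + W g x).
Hypothesis W_bnd : forall f, L2 mu f ->
  L2 nu (W f) /\ (L2norm2 nu (W f) <= C%:E * L2norm2 mu f)%E.
Hypothesis W_inj : forall f, L2 mu f -> aeq nu (W f) (fun=> 0) -> aeq mu f (fun=> 0).
Hypothesis Ws_adj : forall k, L2 nu k -> L2 mu (Ws k) /\
    forall f, L2 mu f -> ip nu (W f) k = ip mu f (Ws k).
Hypothesis phi_meas : measurable_fun [set: mR R] (phi : mR R -> R).
Hypothesis phi_gt0 : forall s, 0 < phi s.
Hypothesis phiE : forall g, L2 nu g -> aeq nu (W (Ws g)) (fun s => (phi s)%:C * g s).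
Hypothesis W_aeq : forall f g, L2 mu f -> L2 mu g -> aeq mu f g -> aeq nu (W f) (W g).
Implicit Types (f g k : R -> R[i]).

Local Notation W_L2 := (W_L2 W_bnd).
Local Notation Ws_L2 := (Ws_L2 Ws_adj).
Local Notation WsE := (WsE Ws_adj).

(** This is phi^(-1/2); the exponential form makes positivity and measurability immediate. *)
Definition polar_weight s := expR (- (ln (phi s) / 2)).
Local Notation h := polar_weight.

Lemma polar_weight_gt0 s : 0 < h s. Proof. exact: expR_gt0. Qed.

Lemma polar_weight_sqr s : h s ^+ 2 * phi s = 1.
Proof.
rewrite /h expr2 -expRD -opprD -splitr expRN lnK ?posrE// mulVf//.
by rewrite gt_eqF.
Qed.

Lemma polar_weight_meas : measurable_fun [set: mR R] (h : mR R -> R).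
Proof.
apply: (measurableT_comp (@measurable_expR R)).
apply: measurable_funN; apply: measurable_funM => //.
exact: (measurableT_comp (@measurable_ln R)).
Qed.

Definition polar_part f s := (h s)%:C * W f s.
Local Notation U := polar_part.
(** On [A n] the weight h is bounded, so the truncated weight [t n] acts on L^2(nu); since phi > 0
    everywhere, the indicators [u n] tend to 1 at every point. *)
Let A n : set (mR R) := [set s | n.+1%:R^-1 <= phi s].
Let u n (s : R) : R := \1_(A n) s.
Let t n s := u n s * h s.

Lemma level_indic_bounded n : bounded_mfun (u n).
Proof.
split; last first.
  by exists 1 => s; rewrite /u indicE; case: (s \in A n); rewrite ?normr1 ?normr0.
apply: measurable_indic; rewrite -[A n]setTI.
by apply: measurable_fun_le => //; exact: measurable_cst.
Qed.

Lemma level_indic_sqr n s : u n s * u n s = u n s.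
Proof. by rewrite /u indicE; case: (s \in A n); rewrite ?mulr1 ?mulr0. Qed.

Lemma level_indic_le1 n s : `|u n s| <= 1.
Proof. by rewrite /u indicE; case: (s \in A n); rewrite ?normr1 ?normr0. Qed.

Lemma cvg_level_indic s : u n s @[n --> \oo] --> (1 : R).
Proof.
apply: cvg_near_cst; near=> n.
rewrite /u indicE mem_set// /A /= invf_ple ?posrE//.
rewrite (@le_trans _ _ n%:R) ?ler_nat//; near: n; exact: nbhs_infty_ger.
Unshelve. all: by end_near.
Qed.

Lemma level_weight_bounded n : bounded_mfun (t n).
Proof.
split; first by apply: measurable_funM; [exact: (level_indic_bounded n).1|exact: polar_weight_meas].
exists n.+1%:R => s; rewrite /t /u indicE.
have [/set_mem As|_] := boolP (s \in A n); last by rewrite mul0r normr0.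
rewrite mul1r ger0_norm; last exact: ltW (polar_weight_gt0 s).
have n1 : 1 <= n.+1%:R :> R by rewrite ler1n.
have p1 : 1 <= phi s * n.+1%:R by rewrite -ler_pdivrMr ?mul1r//; lra.
have h0 := polar_weight_gt0 s; have := polar_weight_sqr s; have := phi_gt0 s.
move: p1 n1 h0; set N := n.+1%:R; set p := phi s; set q := h s => p1 n1 h0 p0 e.
rewrite -(@ler_pXn2r _ 2) ?nnegrE ?(ltW h0) ?(le_trans ler01 n1)//.
apply: (@le_trans _ _ (q ^+ 2 * (p * N))); first by rewrite ler_peMr ?sqr_ge0.
by rewrite mulrA e mul1r expr2 ler_peMr//; lra.
Qed.

(** Let g = t_n W f and k = t_n g. Then |g|^2 = (f, Ws k), and |Ws k|^2 = (phi k, k) = |g|^2 because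
    t_n^2 phi = u_n. Cauchy-Schwarz gives |g| <= |f| for the norms, and Fatou's lemma lets n tend to
    infinity. *)
Lemma polar_part_contraction f : L2 mu f -> L2 nu (U f) /\ n2 nu (U f) <= n2 mu f.
Proof.
move=> Lf; have LW := W_L2 Lf.
pose g n s := (t n s)%:C * W f s.
have Lg n : L2 nu (g n) by exact: bounded_mfun_L2 (level_weight_bounded n) LW.
pose k n s := (t n s)%:C * g n s.
have Lk n : L2 nu (k n) by exact: bounded_mfun_L2 (level_weight_bounded n) (Lg n).
have e1 n : n2 nu (g n) = ip mu f (Ws (k n)).
  rewrite -WsE// -ipff /g ipMl -/(g n); congr ip; apply/funext => s.
  by rewrite /k conjc_real.
have e2 n : n2 mu (Ws (k n)) = n2 nu (g n).
  rewrite -ipff -WsE//; last exact: Ws_L2.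
  have mpk : cmeasurable (fun s => (phi s)%:C * k n s).
    by apply: cmeasurableM; [exact: cmeasurable_real|exact: (Lk n).1].
  rewrite (ip_ae _ mpk _ (phiE (Lk n))); [|by apply: (W_L2 _).1; exact: Ws_L2|exact: (Lk n).1].
  congr (Rint nu); apply/funext => s.
  have e : (t n s) ^+ 2 * phi s = u n s.
    by rewrite /t exprMn -mulrA polar_weight_sqr mulr1 expr2 level_indic_sqr.
  have e' : u n s * t n s = t n s by rewrite /t mulrA level_indic_sqr.
  transitivity ((t n s ^+ 2 * phi s) * cabs2 (g n s)).
    by rewrite /k /cabs2 !ReImE /=; ring.
  by rewrite e /g cabs2M mulrA /cabs2 /= expr0n addr0 expr2 mulrA e'.
have le n : n2 nu (g n) <= n2 mu f.
  have := ip_CS Lf (Ws_L2 (Lk n)); rewrite -e1 e2.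
  have [-> _|g0] := eqVneq (n2 nu (g n)) 0; first exact: n2_ge0.
  by rewrite expr2 ler_pM2r// lt_neqAle eq_sym g0 n2_ge0.
have mU : cmeasurable (U f).
  by apply: cmeasurableM LW.1; apply: cmeasurable_real; exact: polar_weight_meas.
have [i1 i2] : intg nu (fun s : mR R => cabs2 (U f s)) /\ Rint nu (fun s : mR R => cabs2 (U f s)) <= n2 mu f.
  apply: (@fatou_bound _ _ _ nu (fun n (s : mR R) => cabs2 (g n s))) => //.
  - by move=> n; exact: L2_cabs2.
  - by move=> n s; exact: cabs2_ge0.
  - by move=> s; exact: cabs2_ge0.
  - exact: cmeasurable_cabs2.
  - apply: nearW => s; apply: ccvg_cabs2; apply: ccvgM; last exact: ccvg_cst.
    split => /=; last exact: cvg_cst.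
    suff : t n s @[n --> \oo] --> 1 * h s by rewrite mul1r.
    by apply: cvgM; [exact: cvg_level_indic|exact: cvg_cst].
by split => //; split => //; rewrite (RintE i1) ltry.
Qed.

Lemma polar_part_lin a f g : L2 mu f -> L2 mu g ->
  aeq nu (U (fun x => a * f x + g x)) (fun x => a * U f x + U g x).
Proof.
move=> Lf Lg; apply: filterS (W_lin a Lf Lg) => s e.
by rewrite /U e; ring.
Qed.

(** On truncated functions the adjoint is explicit: Us (u_n g) = Ws (t_n g), and U maps this to h
    phi t_n g = u_n g. A weak limit gives U Us = 1, hence surjectivity. Then U Us U f = U f, and
    injectivity yields Us U f = f, which is the isometry. *)
Lemma polar_part_unitary : unitary_op mu nu U.
Proof.
have U_L2 f : L2 mu f -> L2 nu (U f) by move=> /polar_part_contraction[].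
have [Us Us_adj] : exists Us, forall k, L2 nu k -> L2 mu (Us k) /\
    forall f, L2 mu f -> ip nu (U f) k = ip mu f (Us k).
  apply: (@ex_adjoint _ mu nu U 1); first exact: polar_part_lin.
  move=> f Lf; have [LU le] := polar_part_contraction Lf; split => //.
  by rewrite mul1e !L2norm2E// lee_fin.
have Us_L2 k : L2 nu k -> L2 mu (Us k) by move=> /Us_adj[].
have UsE f k : L2 mu f -> L2 nu k -> ip nu (U f) k = ip mu f (Us k).
  by move=> Lf /Us_adj[_]; apply.
have UU_sym g k : L2 nu g -> L2 nu k -> ip nu (U (Us g)) k = ip nu g (U (Us k)).
  move=> Lg Lk; rewrite UsE//; last exact: Us_L2.
  by rewrite [RHS]ipC UsE 1?ipC//; exact: Us_L2.
have UU_trunc n g : L2 nu g -> aeq nu (U (Us (fun s => (u n s)%:C * g s))) (fun s => (u n s)%:C * g s).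
  move=> Lg; set k := fun s => _.
  have Lk : L2 nu k by exact: bounded_mfun_L2 (level_indic_bounded n) Lg.
  have Lt : L2 nu (fun s => (t n s)%:C * g s) by exact: bounded_mfun_L2 (level_weight_bounded n) Lg.
  have Uk : aeq mu (Us k) (Ws (fun s => (t n s)%:C * g s)).
    apply: ip_ext; [exact: Us_L2|exact: Ws_L2|move=> f Lf].
    rewrite ipC -UsE// [RHS]ipC -WsE// /U ipMl; congr ip; apply/funext => s.
    by rewrite /k /t conjc_real; apply: complex_eq; rewrite !ReImE /=; ring.
  have h1 := W_aeq (Us_L2 _ Lk) (Ws_L2 Lt) Uk; have h2 := phiE Lt.
  move: h1 h2; apply: filterS2 => s h1 h2; rewrite /U h1 h2 /k.
  rewrite (_ : (u n s)%:C = (h s ^+ 2 * phi s * u n s)%:C); last first.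
    by rewrite polar_weight_sqr mul1r.
  by rewrite /t; apply: complex_eq; rewrite !ReImE /=; ring.
have UU g : L2 nu g -> aeq nu (U (Us g)) g.
  move=> Lg; have LUg := U_L2 _ (Us_L2 _ Lg).
  apply: ip_ext => // k Lk.
  have lim f1 : L2 nu f1 -> ip nu (fun s => (u n s)%:C * f1 s) k @[n --> \oo] --> ip nu f1 k.
    move=> L1; have := @ip_dct _ nu u (fun=> 1) 1 f1 k level_indic_bounded _ level_indic_le1 cvg_level_indic L1 Lk.
    under [fun s => 1%:C * f1 s]eq_fun do rewrite mul1r; apply.
    by split; [exact: measurable_cst|exists 1 => s; rewrite normr1].
  have L1 := lim _ LUg; have L2' := lim _ Lg.
  (* The real multiplier u_n is moved onto k, then U Us by symmetry, so that only the truncated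
     function u_n k has to be evaluated. *)
  have E : (fun n => ip nu (fun s => (u n s)%:C * U (Us g) s) k) = (fun n => ip nu (fun s => (u n s)%:C * g s) k).
    apply/funext => n.
    have eu (q : R -> R[i]) : ip nu (fun s => (u n s)%:C * q s) k = ip nu q (fun s => (u n s)%:C * k s).
      by rewrite ipMl; congr ip; apply/funext => s; rewrite conjc_real.
    rewrite !eu.
    have Luk : L2 nu (fun s => (u n s)%:C * k s) by exact: bounded_mfun_L2 (level_indic_bounded n) Lk.
    rewrite UU_sym// ipC [RHS]ipC; apply: ip_ae (UU_trunc n k Lk); [|exact: Luk.1|exact: Lg.1].
    by apply: (U_L2 _ _).1; exact: Us_L2.
  by rewrite E in L1; exact: (cvg_unique _ L1 L2').
have Uinj f f' : L2 mu f -> L2 mu f' -> aeq nu (U f) (U f') -> aeq mu f f'.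
  move=> Lf Lf' Uff.
  have Wff : aeq nu (W (fun x => f x - 1 * f' x)) (fun=> 0).
    have := W_sub W_lin 1 Lf Lf'; move: Uff; apply: filterS2 => s e ->.
    have hs : (h s)%:C != 0 by apply/eqP => -[/eqP]; rewrite gt_eqF ?polar_weight_gt0.
    by rewrite mul1r (mulfI hs e) subrr.
  have := W_inj (L2B Lf (L2Z 1 Lf')) Wff; apply: filterS => s /eqP.
  by rewrite mul1r subr_eq0 => /eqP.
split=> [f Lf|g Lg]; last by exists (Us g); split; [exact: Us_L2|exact: UU].
have LU := U_L2 _ Lf; split=> //.
have Lf' := Us_L2 _ LU; have UUf := UU _ LU.
have ff' := Uinj _ _ Lf' Lf UUf.
rewrite !L2norm2E//; congr EFin.
rewrite -(n2_ae Lf'.1 Lf.1 ff') -!ipff -UsE//.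
by apply: ip_ae; [exact: LU.1|exact: (U_L2 _ Lf').1|exact: LU.1|exact: aeq_sym].
Qed.

End unitary_part.

Theorem theorem2p2 (R : realType) (mu nu : bmeasure R) (alpha : R)
    (W : (R -> R[i]) -> (R -> R[i])) :
  (exists a b : R, a != b /\ in_support mu a /\ in_support mu b) ->
  (\int[mu]_(t in [set: mR R]) ((1 + `|(t : R)|)^-1)%:E < +oo)%E ->
  alpha != 0 ->
  bounded_injective_extension mu nu alpha W ->
  exists h : R -> R[i],
    [/\ cmeasurable h,
        (exists M : R, {ae nu, forall x : mR R, h x != 0 /\ cabs (h x)^-1 <= M}),
        unitary_op mu nu (fun f x => h x * W f x)
      & forall lam : R[i], complex.Im lam != 0 ->
          forall f : R -> R[i], L2 mu f ->
            aeq nu (fun s => h s * W (resA mu alpha lam f) s)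
                   (fun s => (s%:C - lam)^-1 * (h s * W f s))].
Proof.
move=> [a [_ [_ [supp _]]]] hmu alpha0 [W_C1c W_aeq W_lin [C W_bnd] W_inj].
have mu_gt0 : (0 < mu [set: mR R])%E.
  apply: lt_le_trans (supp 1 ltr01) _; apply: le_measure; rewrite ?inE//.
  rewrite (_ : [set y | _] = ball a 1 :> set (mR R)); first exact: measurable_ball.
  by apply/seteqP; split => y; rewrite -ball_normE /= distrC.
have [Ws Ws_adj] := ex_adjoint W_lin W_bnd.
pose i0 : R[i] := Complex 0 1.
have i0_im : Im i0 != 0 by rewrite /= oner_eq0.
have den s : rzden i0 s = s ^+ 2 + 1 by rewrite /rzden /= subr0 expr1n.
have den_gt0 (s : R) : 0 < s ^+ 2 + 1 by have := sqr_ge0 s; lra.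
(* This is Im r_i: strictly positive, and in L^2(nu) because it is dominated by |r_i|. *)
pose w s : R := (s ^+ 2 + 1)^-1.
have w_gt0 s : 0 < w s by rewrite invr_gt0.
have sq_meas : measurable_fun [set: mR R] (fun s : mR R => s ^+ 2 + 1).
  by apply: C1r_measurable; apply: C1rD; [apply: C1rM; exact: C1r_id|exact: C1r_cst].
have w_eq s : w s = Im (rz i0 s) by rewrite Im_rz den mul1r.
have Lr := rz_L2_nu hmu mu_gt0 alpha0 W_C1c W_lin W_bnd i0_im.
have w_meas : measurable_fun [set: mR R] (w : mR R -> R).
  by rewrite (funext w_eq); exact: Lr.1.2.
have w_L2 : L2 nu (fun s => (w s)%:C).
  apply: (L2_le _ Lr); first exact: cmeasurable_real.
  move=> s; rewrite cabs2_rz den -/(w s) /cabs2 /= expr0n addr0 expr2 ger_pMl//.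
  by rewrite invf_le1//; have := sqr_ge0 s; lra.
have w_range : exists2 f, L2 mu f & aeq nu (fun s => (complex.Re (W f s))%:C) (fun s => (w s)%:C).
  (* Normalised so that W (c r_i) = - i r_i, whose real part is Im r_i = w. *)
  pose c := - i0 / (1 + alpha%:C * cauchyF mu i0).
  have Lrm := rz_L2 hmu i0_im.
  exists (fun t => c * rz i0 t); first exact: L2Z.
  have h1 := W_scale W_lin c Lrm.
  have h2 := W_rz hmu W_C1c W_lin W_bnd i0_im.
  move: h1 h2; apply: filterS2 => s -> ->.
  rewrite mulrA /c divfK; last exact: denom_neq0.
  by rewrite w_eq !ReImE /= oppr0 mul0r sub0r mulN1r opprK.
have [phi0 phi0_meas phi0E] : exists2 phi : mR R -> R, measurable_fun [set: mR R] phi &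
    forall g, L2 nu g -> aeq nu (W (Ws g)) (fun s => (phi s)%:C * g s).
  apply: (@Phi_multiplication R nu (fun k => W (Ws k)) w).
  - exact: (WWs_L2 W_bnd Ws_adj).
  - exact: (WWs_lin W_aeq W_lin W_bnd Ws_adj).
  - exact: (WWs_sym Ws_adj).
  - move=> z g z0 Lg; have LWg := Ws_L2 Ws_adj Lg.
    apply: aeq_trans (W_resA hmu mu_gt0 alpha0 W_C1c W_lin W_bnd Ws_adj z0 LWg).
    apply: W_aeq; [by apply: (Ws_L2 Ws_adj); exact: rzM_L2|exact: resA_L2|].
    exact: (Ws_rz hmu mu_gt0 alpha0 W_C1c W_lin W_bnd Ws_adj z0 Lg).
  - exact: w_gt0.
  - exact: w_L2.
  - by rewrite (_ : (fun s : mR R => _) = (fun s => s ^+ 2 + 1))//; apply/funext => s; rewrite invrK.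
have bnd := phi_bounds W_bnd Ws_adj w_gt0 w_L2 w_range phi0_meas phi0E.
pose K := `|C| + 1.
(* The symbol is positive only a.e.; on the exceptional null set it is replaced by a positive
   constant so that ln and h are meaningful everywhere. *)
pose phi s := if 0 < phi0 s then phi0 s else K.
have K0 : 0 < K by rewrite /K; have := normr_ge0 C; lra.
have phi_gt0 s : 0 < phi s by rewrite /phi; case: ifPn.
have phi_meas : measurable_fun [set: mR R] (phi : mR R -> R).
  by apply: measurable_fun_ifT => //; exact: measurable_fun_ltr.
have phiE g : L2 nu g -> aeq nu (W (Ws g)) (fun s => (phi s)%:C * g s).
  by move=> Lg; move: (phi0E g Lg) bnd; apply: filterS2 => s -> [p0 _]; rewrite /phi p0.
exists (fun s => (polar_weight phi s)%:C); split.
- by apply: cmeasurable_real; exact: polar_weight_meas.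
(* Here 1/h is the square root of phi, and phi <= |C| almost everywhere. *)
- exists (Num.sqrt `|C|); apply: filterS bnd => s [p0 pC].
  have h0 := polar_weight_gt0 phi s; split.
    by apply/eqP => -[/eqP]; rewrite gt_eqF.
  rewrite /cabs cabs2V /cabs2 /= expr0n addr0; apply: ler_wsqrtr.
  have h2 : polar_weight phi s ^+ 2 != 0 by rewrite expf_neq0// gt_eqF.
  suff -> : (polar_weight phi s ^+ 2)^-1 = phi s by rewrite /phi p0.
  by apply: (mulfI h2); rewrite mulfV// polar_weight_sqr.
- exact: (polar_part_unitary W_lin W_bnd W_inj Ws_adj phi_meas phi_gt0 phiE W_aeq).
- move=> lam lam0 f Lf.
  have := W_resA hmu mu_gt0 alpha0 W_C1c W_lin W_bnd Ws_adj lam0 Lf.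
  by apply: filterS => s ->; rewrite mulrCA.
Qed.
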